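(* For any $n$-node unweighted undirected input graph $G$, there is a randomized algorithm that runs in $\widetilde{O}(n^{3/2})$ time and with high probability computes an adjacency oracle for a $3$-spanner $H$ of $G$ with $|E(H)|=\widetilde{O}(n^{3/2})$.
   Context: A $t$-spanner of $G$ is an edge-subgraph $H$ with $\mathrm{dist}_H(s,t')\le t\cdot\mathrm{dist}_G(s,t')$ for all vertices $s,t'$. The input graph $G$ is given both as an adjacency list (degree, neighbor list and uniformly random neighbor available in $\widetilde{O}(1)$ time per access) and as an adjacency matrix/oracle (edge membership testable in $\widetilde{O}(1)$ time). An adjacency oracle for $H$ is a data structure that, on query $(u,v)$, deterministically returns in $\widetilde{O}(1)$ time a bit indicating whether $(u,v)\in E(H)$; $H$ is fixed at the end of construction. Running time means construction time. $\widetilde{O}$ hides $\mathrm{polylog}(n)$ factors; ''with high probability'' means probability at least $1-1/n^{c}$ for an absolute constant $c>0$. *)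

(* Defs.v *)
From mathcomp Require Export all_boot all_order all_algebra.
From mathcomp Require Export all_classical all_reals all_analysis.

Set Implicit Arguments.
Unset Strict Implicit.
Unset Printing Implicit Defensive.

Import Order.TTheory GRing.Theory Num.Theory.
Local Open Scope ring_scope.

(** * Graphs, distances, spanners *)

Record sgraph (n : nat) := SGraph {
  adj :> rel 'I_n;
  adj_sym : symmetric adj;
  adj_irr : irreflexive adj }.

Definition num_edges (n : nat) (G : sgraph n) : nat :=
  #|[set e : 'I_n * 'I_n | (e.1 < e.2)%N && G e.1 e.2]|.

(** Infimum of the lengths of the walks from [s] to [t]; it is [+oo] when there
    is none. *)
Definition dist (R : realType) (n : nat) (G : sgraph n) (s t : 'I_n) : \bar R :=
  ereal_inf [set x | exists p : seq 'I_n,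
    [/\ path G s p, last s p = t & x = ((size p)%:R : R)%:E]].

Definition spanner (R : realType) (k n : nat) (G H : sgraph n) : Prop :=
  subrel H G /\
  forall s t : 'I_n, (dist R H s t <= (k%:R : R)%:E * dist R G s t)%E.

(** The order in which each list enumerates the neighbors is part of the input
    and is arbitrary. *)
Record adjlist (n : nat) (G : sgraph n) := AdjList {
  nbrs :> 'I_n -> seq 'I_n;
  nbrs_uniq : forall u, uniq (nbrs u);
  nbrs_mem : forall u, nbrs u =i G u }.

(** * Randomized word RAM with access to an input graph *)

Inductive binop := OAdd | OSub | OMul | ODiv | OMod | OLt | OEq.

(** All operands [d], [a], [b] are register names; [d] is the destination. *)
Inductive instr :=
| IConst (d c : nat)
| IBin (o : binop) (d a b : nat)
| ILoad (d a : nat)          (* d := mem[a] *)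
| IStore (a b : nat)         (* mem[a] := b *)
| IRand (d a : nat)          (* d := uniform element of {0, .., a - 1} *)
| IDeg (d a : nat)           (* d := degree of vertex a *)
| INbr (d a b : nat)         (* d := b-th neighbor of vertex a, from 0 *)
| IRandNbr (d a : nat)       (* d := uniformly random neighbor of vertex a *)
| IAdj (d a b : nat).        (* d := 1 if ab is an edge, else 0 *)

Inductive prog :=
| Skip
| Do (i : instr)
| Seq (p q : prog)
| If (r : nat) (p q : prog)
| While (r : nat) (p : prog).

Definition det_instr (i : instr) : bool :=
  match i with IRand _ _ | IRandNbr _ _ => false | _ => true end.

Fixpoint deterministic (p : prog) : bool :=
  match p with
  | Skip => true
  | Do i => det_instr i
  | Seq p q | If _ p q => deterministic p && deterministic q
  | While _ p => deterministic p
  end.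

Record state := State { regs : nat -> nat; memory : nat -> nat }.

Definition set_reg (s : state) (d x : nat) : state :=
  State [eta regs s with d |-> x] (memory s).

Definition set_mem (s : state) (a x : nat) : state :=
  State (regs s) [eta memory s with a |-> x].

(** Results that exceed the word length are reduced by [wrap]; [OSub] is
    truncated at 0, and [ODiv] by 0 returns 0. *)
Definition eval_binop (o : binop) (x y : nat) : nat :=
  match o with
  | OAdd => x + y
  | OSub => x - y
  | OMul => x * y
  | ODiv => x %/ y
  | OMod => x %% y
  | OLt => x < y
  | OEq => x == y
  end%N.

Definition wrap (w x : nat) : nat := (x %% 2 ^ w)%N.

(** The list of neighbors of the vertex named by the word [x]; empty if [x] does
    not name a vertex. *)
Definition nbr_words (n : nat) (G : sgraph n) (L : adjlist G) (x : nat) :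
    seq nat :=
  if insub x is Some u then [seq val v | v <- L u] else [::].

Definition adj_words (n : nat) (G : sgraph n) (x y : nat) : bool :=
  match insub x, insub y with Some u, Some v => G u v | _, _ => false end.

(** The equiprobable outcomes of one instruction, for words of [w] bits. This
    list is never empty: [IRand] below 0 and [IRandNbr] at a vertex without
    neighbors return 0. *)
Definition outcomes (n : nat) (G : sgraph n) (L : adjlist G) (w : nat)
    (i : instr) (s : state) : seq state :=
  let r := regs s in
  match i with
  | IConst d c => [:: set_reg s d (wrap w c)]
  | IBin o d a b => [:: set_reg s d (wrap w (eval_binop o (r a) (r b)))]
  | ILoad d a => [:: set_reg s d (memory s (r a))]
  | IStore a b => [:: set_mem s (r a) (r b)]
  | IRand d a => [seq set_reg s d x | x <- iota 0 (maxn 1 (r a))]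
  | IDeg d a => [:: set_reg s d (size (nbr_words L (r a)))]
  | INbr d a b => [:: set_reg s d (nth 0%N (nbr_words L (r a)) (r b))]
  | IRandNbr d a =>
      if nbr_words L (r a) is [::] then [:: set_reg s d 0%N]
      else [seq set_reg s d x | x <- nbr_words L (r a)]
  | IAdj d a b => [:: set_reg s d (adj_words G (r a) (r b))]
  end.

(** A configuration is a stack of programs that remain to be run, together with
    a state; the machine has halted when the stack is empty. Every step, in
    particular every access to the input graph, takes one unit of time. *)
Definition config : Type := (seq prog * state)%type.

Definition step (n : nat) (G : sgraph n) (L : adjlist G) (w : nat)
    (c : config) : seq config :=
  let s := c.2 in
  match c.1 with
  | [::] => [:: c]
  | Skip :: k => [:: (k, s)]
  | Do i :: k => [seq (k, s') | s' <- outcomes L w i s]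
  | Seq p q :: k => [:: (p :: q :: k, s)]
  | If r p q :: k => [:: ((if regs s r != 0%N then p else q) :: k, s)]
  | While r p :: k =>
      [:: (if regs s r != 0%N then p :: While r p :: k else k, s)]
  end.

(** Every run from [c] halts within [T] steps in a state that satisfies [E]. *)
Fixpoint always (n : nat) (G : sgraph n) (L : adjlist G) (w T : nat)
    (E : pred state) (c : config) : bool :=
  if c.1 is [::] then E c.2
  else if T is T'.+1 then all (always L w T' E) (step L w c) else false.

(** Probability that the run from [c] halts within [T] steps in a state that
    satisfies [E]. *)
Fixpoint prob (R : realType) (n : nat) (G : sgraph n) (L : adjlist G)
    (w T : nat) (E : state -> Prop) (c : config) : R :=
  if c.1 is [::] then (`[< E c.2 >])%:R
  else if T is T'.+1 then
    (\sum_(c' <- step L w c) prob R L w T' E c') / (size (step L w c))%:R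
  else 0.

(** [kappa] times the length of the binary expansion of [n]. *)
Definition word_size (kappa n : nat) : nat := (kappa * (trunc_log 2 n).+1)%N.

Definition init_construct (n : nat) : state :=
  State [eta (fun=> 0%N) with 0%N |-> n] (fun=> 0%N).

(** A query runs on the memory that the construction left behind, with fresh
    registers that hold [n], [u] and [v]. *)
Definition init_query (n : nat) (m : nat -> nat) (u v : 'I_n) : state :=
  State [eta (fun=> 0%N) with 0%N |-> n, 1%N |-> val u, 2%N |-> val v] m.

(** The memory [m], queried with [Q], answers adjacency queries to [H] in time
    [q]; the answer bit is read in register 0. Every query starts from the same
    [m], so the answers do not depend on earlier queries. *)
Definition adjacency_oracle (n : nat) (G : sgraph n) (L : adjlist G)
    (w : nat) (Q : prog) (q : nat) (m : nat -> nat) (H : sgraph n) : Prop :=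
  deterministic Q /\
  forall u v : 'I_n,
    always L w q (fun s => regs s 0%N == H u v :> nat)
      ([:: Q], init_query m u v).

(** * Asymptotics *)

Definition Otilde (R : realType) (f g : nat -> R) : Prop :=
  exists (C : R) (k : nat), forall n : nat, (2 <= n)%N ->
    f n <= C * g n * ln (n%:R) ^+ k.

(* Main.v *)
Require Import Defs.
From mathcomp Require Import zify ring lra.

Set Implicit Arguments.
Unset Strict Implicit.
Unset Printing Implicit Defensive.

Import Order.TTheory GRing.Theory Num.Theory.
Local Open Scope ring_scope.

(** Draw K = O~(sqrt n) uniform vertices s_0, s_1, ... and K uniform neighbors of
    every vertex. The center of v is the first s_i adjacent to v. For every u and
    every center c, if a sampled neighbor of u has center c, then one such
    neighbor is selected. An edge uv of G is kept if v is the center of u, or if v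
    is the selected neighbor of u for the center of v, or if deg u <= deg v and u
    has no selected neighbor for the center of v (and likewise with u and v
    exchanged). The edges of the third kind are too many to be listed in time
    O~(n^(3/2)), but a query recognizes them from the tables of centers and
    selected neighbors.

    The kept edges always form a 3-spanner: if uv is discarded and
    deg u <= deg v, then u has a selected neighbor x with the same center as v.
    Randomness only matters for the size. With high probability a vertex of
    degree d > r ~ sqrt n has its center among the first O~(n / d) draws, and u
    has a selected neighbor for every cluster that contains a fraction 1/r of its
    neighbors. The edges of the third kind at u, whose other ends have degree at
    least d = deg u, hence lie in O~(n / d) clusters with at most d / r neighbors
    of u each, which makes O~(sqrt n) edges. *)

(** * Deterministic runs of the machine *)

Section Machine.
Local Open Scope nat_scope.
Variables (n : nat) (G : sgraph n) (L : adjlist G) (w : nat).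

(** The stack must be nonempty before each step: [always] and [prob] stop at an empty stack without
    spending time, whereas [step] would loop there. *)
Fixpoint reach (t : nat) (c c' : config) : Prop :=
  if t is t'.+1 then
    c.1 <> [::] /\ exists2 c1, step L w c = [:: c1] & reach t' c1 c'
  else c = c'.

Lemma reach_trans t1 t2 c1 c2 c3 :
  reach t1 c1 c2 -> reach t2 c2 c3 -> reach (t1 + t2) c1 c3.
Proof.
elim: t1 c1 => [|t1 IH] c1 /= => [-> //|[ne [c st r1]] r2].
by split=> //; exists c => //; exact: IH.
Qed.

Lemma reach_step p k s c :
  step L w (p :: k, s) = [:: c] -> reach 1 (p :: k, s) c.
Proof. by move=> st; split=> //; exists c. Qed.

Lemma step_do i k s :
  step L w (Do i :: k, s) = [seq (k, s') | s' <- outcomes L w i s].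
Proof. by []. Qed.

Lemma step_while f p k s :
  step L w (While f p :: k, s) =
  [:: (if regs s f != 0 then p :: While f p :: k else k, s)].
Proof. by []. Qed.

Lemma always_reach t T E c c' :
  reach t c c' -> always L w (t + T) E c = always L w T E c'.
Proof.
elim: t c => [|t IH] [k s] /= => [->//|[ne [c1 st r]]].
by case: k ne st => [//|p k] _ st; rewrite st /= (IH _ r) andbT.
Qed.

Lemma prob_reach (R : realType) t T E c c' :
  reach t c c' -> prob R L w (t + T) E c = prob R L w T E c'.
Proof.
elim: t c => [|t IH] [k s] /= => [->//|[ne [c1 st r]]].
case: k ne st => [//|p k] _ st; rewrite st /= big_seq1 divr1.
exact: IH.
Qed.

(** [runs p t s Q]: from [s], [p] takes exactly [t] steps, makes no random
    choice, and ends in a state that satisfies [Q]. *)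
Definition runs (p : prog) (t : nat) (s : state) (Q : state -> Prop) : Prop :=
  forall k, exists2 s', reach t (p :: k, s) (k, s') & Q s'.

Lemma runs_mono p t s (Q Q' : state -> Prop) :
  (forall s', Q s' -> Q' s') -> runs p t s Q -> runs p t s Q'.
Proof. by move=> QQ' run k; have [s' r /QQ'] := run k; exists s'. Qed.

Lemma runs_seq p q t1 t2 s Q :
  runs p t1 s (fun s' => runs q t2 s' Q) -> runs (Seq p q) (t1 + t2).+1 s Q.
Proof.
move=> run k; have [s1 r1 run2] := run (q :: k).
have [s2 r2 Qs2] := run2 k; exists s2 => //=.
split=> //; eexists; first reflexivity.
exact: reach_trans r1 r2.
Qed.

Lemma runs_do i s s' (Q : state -> Prop) :
  outcomes L w i s = [:: s'] -> Q s' -> runs (Do i) 1 s Q.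
Proof.
move=> out Qs k; exists s' => //; apply: reach_step.
by rewrite step_do out.
Qed.

(** [Inv i] describes the states in which [i] iterations remain. *)
Lemma runs_while (Inv : nat -> state -> Prop) f p t N s :
  (forall i s, Inv i.+1 s -> regs s f != 0 /\ runs p t s (Inv i)) ->
  (forall s, Inv 0 s -> regs s f = 0) ->
  Inv N s -> runs (While f p) (N * t.+1).+1 s (Inv 0).
Proof.
move=> IS I0; elim: N s => [|N IH] s Is k.
  by exists s => //; apply: reach_step; rewrite step_while (I0 _ Is).
have [nz run] := IS _ _ Is.
have [s1 r1 Is1] := run (While f p :: k).
have [s2 r2 Is2] := IH _ Is1 k.
exists s2 => //; rewrite mulSn -addnS addSn; split=> //.
by eexists; [rewrite step_while nz; reflexivity | exact: reach_trans r1 r2].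
Qed.

(** * Compiled expressions *)

Inductive expr :=
| Var (r : nat)
| Cst (c : nat)
| Bin (o : binop) (a b : expr)
| Ld (a : expr)
| Deg (a : expr)
| Adj (a b : expr).

(** Registers from [d] on serve as scratch space; the value ends up in [d]. *)
Fixpoint code (e : expr) (d : nat) : prog :=
  match e with
  | Var r => Seq (Do (IConst d 0)) (Do (IBin OAdd d d r))
  | Cst c => Do (IConst d c)
  | Bin o a b => Seq (code a d) (Seq (code b d.+1) (Do (IBin o d d d.+1)))
  | Ld a => Seq (code a d) (Do (ILoad d d))
  | Deg a => Seq (code a d) (Do (IDeg d d))
  | Adj a b => Seq (code a d) (Seq (code b d.+1) (Do (IAdj d d d.+1)))
  end.

Fixpoint eval (e : expr) (s : state) : nat :=
  match e with
  | Var r => regs s r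
  | Cst c => c
  | Bin o a b => eval_binop o (eval a s) (eval b s)
  | Ld a => memory s (eval a s)
  | Deg a => size (nbr_words L (eval a s))
  | Adj a b => adj_words G (eval a s) (eval b s)
  end.

(** Guarantees that nothing wraps, so that the machine computes the exact value [eval]. A variable
    carries a word bound because it is copied by an addition, which wraps. *)
Fixpoint fits (d : nat) (e : expr) (s : state) : Prop :=
  match e with
  | Var r => r < d /\ regs s r < 2 ^ w
  | Cst c => c < 2 ^ w
  | Bin o a b =>
      [/\ fits d a s, fits d b s & eval_binop o (eval a s) (eval b s) < 2 ^ w]
  | Ld a | Deg a => fits d a s
  | Adj a b => fits d a s /\ fits d b s
  end.

(** Meaningful only for programs without loops and branches. *)
Fixpoint len (p : prog) : nat :=
  if p is Seq p q then (len p + len q).+1 else 1.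

Definition agree (d : nat) (s s' : state) : Prop :=
  memory s' = memory s /\ forall r, r < d -> regs s' r = regs s r.

Lemma agree_trans d d' s1 s2 s3 :
  d <= d' -> agree d s1 s2 -> agree d' s2 s3 -> agree d s1 s3.
Proof.
move=> dd [m1 r1] [m2 r2]; split=> [|r rd]; first by rewrite m2.
by rewrite r2 ?r1 // (leq_trans rd).
Qed.

Lemma agree_set_reg d e s x : d <= e -> agree d s (set_reg s e x).
Proof.
by move=> de; split=> // r rd /=; rewrite ltn_eqF // (leq_trans rd).
Qed.

Lemma eval_agree d e s s' :
  agree d s s' -> fits d e s -> eval e s' = eval e s /\ fits d e s'.
Proof.
move=> [m rg]; elim: e => /=.
- by move=> r [rd rw]; rewrite rg.
- by [].
- by move=> o a IHa b IHb [/IHa [-> fa] /IHb [-> fb]] ?; split.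
- by move=> a IHa /IHa [-> fa]; rewrite m.
- by move=> a IHa /IHa [-> fa].
- by move=> a IHa b IHb [/IHa [-> fa] /IHb [-> fb]]; split.
Qed.

Lemma fitsW d d' e s : d <= d' -> fits d e s -> fits d' e s.
Proof.
move=> dd; elim: e => //=.
- by move=> r [rd]; split => //; exact: leq_trans dd.
- by move=> o a IHa b IHb [/IHa fa /IHb fb].
- by move=> a IHa b IHb [/IHa fa /IHb fb].
Qed.

Lemma wrap_small x : x < 2 ^ w -> wrap w x = x.
Proof. exact: modn_small. Qed.

Lemma runs_code e d s (Q : state -> Prop) :
  fits d e s ->
  (forall s', agree d s s' -> regs s' d = eval e s -> Q s') ->
  runs (code e d) (len (code e d)) s Q.
Proof.
elim: e d s Q => /=.
- move=> r d s Q [rd rw] H; apply: (@runs_seq _ _ 1 1).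
  apply: runs_do; first reflexivity.
  apply: runs_do; first reflexivity.
  apply: H => /=; last by rewrite eqxx ltn_eqF // /wrap mod0n add0n modn_small.
  apply: agree_trans (leqnn _) _ _; last exact: agree_set_reg.
  exact: agree_set_reg.
- move=> c d s Q cw H; apply: runs_do; first reflexivity.
  by apply: H; [exact: agree_set_reg | rewrite /= eqxx wrap_small].
- move=> o a IHa b IHb d s Q [fa fb ow] H.
  apply: runs_seq; apply: IHa => // s1 a1 e1.
  have [eb1 fb1] := eval_agree a1 fb.
  apply: runs_seq; apply: IHb => [|s2 a2 e2]; first exact: fitsW fb1.
  apply: runs_do; first reflexivity.
  apply: H; last first.
    by rewrite /= eqxx e2 eb1 a2.2 // e1 wrap_small.
  apply: (agree_trans (leqnn _)); last exact: agree_set_reg.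
  exact: agree_trans a1 a2.
- move=> a IHa d s Q fa H.
  apply: runs_seq; apply: IHa => // s1 a1 e1.
  apply: runs_do; first reflexivity.
  apply: H; last by rewrite /= eqxx e1 a1.1.
  by apply: (agree_trans (leqnn _) a1); exact: agree_set_reg.
- move=> a IHa d s Q fa H.
  apply: runs_seq; apply: IHa => // s1 a1 e1.
  apply: runs_do; first reflexivity.
  apply: H; last by rewrite /= eqxx e1.
  by apply: (agree_trans (leqnn _) a1); exact: agree_set_reg.
- move=> a IHa b IHb d s Q [fa fb] H.
  apply: runs_seq; apply: IHa => // s1 a1 e1.
  have [eb1 fb1] := eval_agree a1 fb.
  apply: runs_seq; apply: IHb => [|s2 a2 e2]; first exact: fitsW fb1.
  apply: runs_do; first reflexivity.
  apply: H; last by rewrite /= eqxx e2 eb1 a2.2 // e1.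
  apply: (agree_trans (leqnn _)); last exact: agree_set_reg.
  exact: agree_trans a1 a2.
Qed.

(** Registers below [nvars] hold variables, the others are scratch space. *)
Definition nvars := 8.

(** There is no move instruction, so the result is copied by adding it to 0. *)
Definition assign (r : nat) (e : expr) : prog :=
  Seq (code e nvars)
      (Seq (Do (IConst r 0)) (Do (IBin OAdd r r nvars))).

Definition store (a e : expr) : prog :=
  Seq (code a nvars) (Seq (code e nvars.+1) (Do (IStore nvars nvars.+1))).

Lemma runs_assign r e s (Q : state -> Prop) :
  r < nvars -> fits nvars e s -> eval e s < 2 ^ w ->
  (forall s', memory s' = memory s -> regs s' r = eval e s ->
     (forall x, x < nvars -> x != r -> regs s' x = regs s x) -> Q s') ->
  runs (assign r e) (len (assign r e)) s Q.
Proof.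
move=> rv fe ew H; apply: runs_seq; apply: runs_code => // s1 [m1 r1] e1.
apply: (@runs_seq _ _ 1 1); apply: runs_do; first reflexivity.
apply: runs_do; first reflexivity.
apply: H => [//| |x xv xr] /=.
  by rewrite eqxx gtn_eqF // e1 /wrap mod0n add0n modn_small.
by rewrite (negPf xr) r1.
Qed.

Lemma runs_store a e s (Q : state -> Prop) :
  fits nvars a s -> fits nvars e s ->
  (forall s', memory s' = [eta memory s with eval a s |-> eval e s] ->
     (forall x, x < nvars -> regs s' x = regs s x) -> Q s') ->
  runs (store a e) (len (store a e)) s Q.
Proof.
move=> fa fe H; apply: runs_seq; apply: runs_code => // s1 a1 e1.
have [eb1 fb1] := eval_agree a1 fe.
apply: runs_seq; apply: runs_code => [|s2 a2 e2]; first exact: fitsW fb1.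
apply: runs_do; first reflexivity.
have [m3 r3] := agree_trans (leqnSn _) a1 a2.
by apply: H => [|x xv] /=; [rewrite m3 e2 eb1 a2.2 // e1 | rewrite r3].
Qed.

(** The body runs with register [r] equal to N - 1, ..., 0. *)
Definition for_down (r : nat) (e : expr) (p : prog) : prog :=
  Seq (assign r e)
      (While r (Seq (assign r (Bin OSub (Var r) (Cst 1))) p)).

Definition decr_len (r : nat) := len (assign r (Bin OSub (Var r) (Cst 1))).

Definition for_time (r : nat) (e : expr) (N t : nat) : nat :=
  (len (assign r e) + (N * (decr_len r + t).+2).+1).+1.

(** Registers below [r] are constant during the loop, so the invariant only
    concerns the memory; [Inv j] holds when the indices from [j] on have been
    treated. *)
Lemma runs_for (Inv : nat -> (nat -> nat) -> Prop) r e p t N s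
    (Q : state -> Prop) :
  0 < w -> r < nvars -> fits nvars e s -> eval e s = N -> N < 2 ^ w ->
  Inv N (memory s) ->
  (forall j s', j < N -> regs s' r = j ->
     (forall x, x < r -> regs s' x = regs s x) -> Inv j.+1 (memory s') ->
     runs p t s' (fun s'' => Inv j (memory s'') /\
       forall x, x <= r -> regs s'' x = regs s' x)) ->
  (forall s', Inv 0 (memory s') ->
     (forall x, x < r -> regs s' x = regs s x) -> Q s') ->
  runs (for_down r e p) (for_time r e N t) s Q.
Proof.
move=> w0 rv fe <- ew I0 step HQ; apply: runs_seq; apply: runs_assign => // s0 m0 r0 x0.
have xr x : x < r -> x < nvars /\ x != r.
  by move=> xr; rewrite (ltn_trans xr) // ltn_eqF.
pose I i s' := [/\ regs s' r = i, i <= eval e s, Inv i (memory s') &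
   forall x, x < r -> regs s' x = regs s x].
have: I (eval e s) s0.
  by split=> //; [rewrite m0|move=> x /xr [xv xr']; exact: x0].
move=> /(@runs_while I r (Seq (assign r (Bin OSub (Var r) (Cst 1))) p)
          (decr_len r + t).+1) H.
apply: runs_mono (H _ _); first by move=> s' [_ _ Is rs]; exact: HQ.
- move=> i s1 [r1 i1 I1 x1]; split; first by rewrite r1.
  have iw : i.+1 < 2 ^ w by exact: leq_ltn_trans ew.
  have one : 1 < 2 ^ w by rewrite -{1}(expn0 2) ltn_exp2l.
  apply: runs_seq; apply: runs_assign => //=.
  + by rewrite r1 subn1; do !split=> //; exact: ltnW.
  + by rewrite r1 subn1; exact: ltnW.
  move=> s2 m2 r2 x2.
  rewrite r1 subn1 /= in r2.
  have x2' x : x < r -> regs s2 x = regs s x.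
    by move=> /[dup] /xr [xv xr'] /x1 <-; exact: x2.
  apply: runs_mono (step i s2 _ _ _ _) => //; last by rewrite m2.
  move=> s3 [I3 x3]; split=> //; [by rewrite x3|exact: ltnW|].
  by move=> x xr'; rewrite x3 ?x2' // ltnW.
- by move=> s' [].
Qed.

End Machine.

(** * Averages over random memory cells *)

Section Averages.
Variable R : realType.

Definition mean (A : seq nat) (f : nat -> R) : R :=
  (\sum_(x <- A) f x) / (size A)%:R.

Lemma ler_mean A f g :
  {in A, forall x, f x <= g x} -> mean A f <= mean A g.
Proof.
move=> fg; apply: ler_wpM2r; first by rewrite invr_ge0.
by rewrite big_seq [leRHS]big_seq; apply: ler_sum.
Qed.

Lemma mean_sum (I : Type) (r : seq I) A (F : I -> nat -> R) :
  mean A (fun x => \sum_(i <- r) F i x) = \sum_(i <- r) mean A (F i).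
Proof. by rewrite /mean exchange_big mulr_suml. Qed.

Lemma meanD A (f g : nat -> R) :
  mean A (fun x => f x + g x) = mean A f + mean A g.
Proof. by rewrite /mean big_split mulrDl. Qed.

Lemma mean_const A (c : R) : A != [::] -> mean A (fun=> c) = c.
Proof.
move=> A0; rewrite /mean big_const_seq count_predT iter_addr_0 -[c *+ _]mulr_natr mulfK //.
by rewrite pnatr_eq0 size_eq0.
Qed.

Variables (A : nat -> seq nat) (a : nat -> nat).

(** Mean of [f] over the memories obtained from [m] by filling the cells
    [a j], for [j < N], with independent uniform elements of [A j]. *)
Fixpoint avg (N : nat) (f : (nat -> nat) -> R) (m : nat -> nat) : R :=
  if N is j.+1 then mean (A j) (fun x => avg j f [eta m with a j |-> x])
  else f m.

(** [P] is a property that the writes preserve; it serves to record cells fixed by earlier draws. *)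
Lemma ler_avg (P : (nat -> nat) -> Prop) N f g m :
  (forall m j x, (j < N)%N -> x \in A j -> P m -> P [eta m with a j |-> x]) ->
  (forall m, P m -> f m <= g m) -> P m -> avg N f m <= avg N g m.
Proof.
move=> wr fg; elim: N m wr => [|N IH] m wr Pm /=; first exact: fg.
apply: ler_mean => x xA; apply: IH; last exact: wr.
by move=> m' j y jN; apply: wr; exact: ltnW.
Qed.

Lemma avg_sum (I : Type) (r : seq I) N (F : I -> (nat -> nat) -> R) m :
  avg N (fun m => \sum_(i <- r) F i m) m = \sum_(i <- r) avg N (F i) m.
Proof.
elim: N m => [//|N IH] m /=.
by under eq_fun do rewrite IH; rewrite mean_sum.
Qed.

Lemma avgD N (f g : (nat -> nat) -> R) m :
  avg N (fun m => f m + g m) m = avg N f m + avg N g m.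
Proof.
elim: N m => [//|N IH] m /=.
by under eq_fun do rewrite IH; rewrite meanD.
Qed.

Lemma avg_const N c m : (forall j, A j != [::]) -> avg N (fun=> c) m = c.
Proof.
move=> A0; elim: N m => [//|N IH] m /=.
by under eq_fun do rewrite IH; rewrite mean_const.
Qed.

(** Independence: the cells are distinct, so each index in [J] contributes its own factor [p], the
    bound on the chance to miss [B] there. *)
Lemma avg_avoid (J B : pred nat) (p : R) N m :
  {in gtn N &, injective a} -> (forall j, A j != [::]) -> 0 <= p ->
  (forall j, J j -> (count (predC B) (A j))%:R <= p * (size (A j))%:R) ->
  avg N (fun m => (all (fun j => J j ==> ~~ B (m (a j))) (iota 0 N))%:R) m <=
  p ^+ count J (iota 0 N).
Proof.
move=> ainj A0 p0 pB.
(* [avg] fills the highest index first, so [f N' M] is the part of the event that concerns the cells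
   already filled. *)
pose f N' M m : R := (all (fun j => J j ==> ~~ B (m (a j))) (iota N' M))%:R.
suff H N' M : (N' + M = N)%N ->
    avg N' (f 0%N N) m <= p ^+ count J (iota 0 N') * f N' M m.
  by apply: le_trans (H N 0%N (addn0 _)) _; rewrite /f mulr1.
elim: N' M m => [|N' IH] M m NM; first by rewrite expr0 mul1r -NM.
have -> : count J (iota 0 N'.+1) = (count J (iota 0 N') + J N')%N.
  by rewrite -[N'.+1]addn1 iotaD count_cat /= addn0.
rewrite exprD [avg _ _ _]/=.
apply: (@le_trans _ _ (mean (A N') (fun x => p ^+ count J (iota 0 N') *
    (f N'.+1 M m * (J N' ==> ~~ B x)%:R)))).
  apply: ler_mean => x xA; apply: le_trans (IH M.+1 _ _) _; first by lia.
  apply: ler_wpM2l; first exact: exprn_ge0.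
  rewrite /f /= eqxx -natrM mulnb andbC ler_nat leq_eqVlt; apply/orP; left.
  apply/eqP; congr (nat_of_bool (_ && _)).
  apply: eq_in_all => j; rewrite mem_iota => /andP [Nj jM].
  have [/ainj e|//] := eqVneq (a j) (a N').
  suff: j = N' by lia.
  by apply: e; rewrite inE /=; lia.
have sz : (0 : R) < (size (A N'))%:R by rewrite ltr0n lt0n size_eq0.
rewrite /mean -mulr_sumr -mulr_sumr -!mulrA.
apply: ler_wpM2l; first exact: exprn_ge0.
rewrite [leRHS]mulrC.
apply: ler_wpM2l; first by rewrite /f.
rewrite ler_pdivrMr //.
case: (boolP (J N')) => JN.
  rewrite expr1; apply: le_trans (pB _ JN).
  by rewrite -sum1_count natr_sum [leRHS]big_mkcond; apply: ler_sum => x _ /=; case: (B x).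
rewrite expr0 mul1r -sum1_size natr_sum; exact: ler_sum.
Qed.

End Averages.

(** * Runs with random choices *)

Section RandomRuns.
Variables (R : realType) (n : nat) (G : sgraph n) (L : adjlist G) (w : nat).
Variable E : state -> Prop.

(** Here [p] bounds the probability of failure. It is propagated backwards through the program:
    deterministic steps leave it unchanged and a draw turns it into a mean. *)
Definition good (T : nat) (p : R) (c : config) : Prop :=
  always L w T xpredT c /\ 1 - p <= prob R L w T E c.

Lemma prob_ge0 T c : 0 <= prob R L w T E c.
Proof.
elim: T c => [|T IH] [[|p k] s] //=.
by rewrite divr_ge0 // sumr_ge0.
Qed.

Lemma good_done T p s : (E s \/ 1 <= p) -> 0 <= p -> good T p ([::], s).
Proof.
move=> Es p0; split; first by case: T.
have -> : prob R L w T E ([::], s) = (`[< E s >])%:R by case: T.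
case: Es => [Es|p1]; first by rewrite asboolT // lerBlDr lerDl.
by rewrite (@le_trans _ _ 0) // subr_le0.
Qed.

Lemma good_reach t T p c c' :
  reach L w t c c' -> good T p c' -> good (t + T) p c.
Proof.
by move=> r [H1 H2]; split; rewrite ?(always_reach _ _ r) ?(prob_reach _ _ _ r).
Qed.

Lemma good_runs q t T p k s (Q : state -> Prop) :
  runs L w q t s Q -> (forall s', Q s' -> good T p (k, s')) ->
  good (t + T) p (q :: k, s).
Proof. by move=> run H; have [s' r /H] := run k; exact: good_reach. Qed.

Lemma good_seq T p q1 q2 k s :
  good T p (q1 :: q2 :: k, s) -> good T.+1 p (Seq q1 q2 :: k, s).
Proof. by apply: (@good_reach 1); exact: reach_step. Qed.

Lemma good_draw i d A T (f : nat -> R) k s :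
  A != [::] -> outcomes L w i s = [seq set_reg s d x | x <- A] ->
  {in A, forall x, good T (f x) (k, set_reg s d x)} ->
  good T.+1 (mean A f) (Do i :: k, s).
Proof.
move=> A0 out H; rewrite /good.
have -> : always L w T.+1 xpredT (Do i :: k, s) =
  all (always L w T xpredT) (step L w (Do i :: k, s)) by [].
have -> : prob R L w T.+1 E (Do i :: k, s) =
  (\sum_(c' <- step L w (Do i :: k, s)) prob R L w T E c') /
  (size (step L w (Do i :: k, s)))%:R by [].
rewrite step_do out -map_comp size_map big_map; split.
  by rewrite all_map; apply/allP => x xA; have [] := H _ xA.
have -> : 1 - mean A f = mean A (fun x => 1 - f x).
  by rewrite -{1}(@mean_const R A 1 A0) /mean sumrB mulrBl.
by apply: ler_mean => x xA; have [] := H _ xA.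
Qed.

(** Random counterpart of [runs_for], for a body that fills the cell [a j] with a draw from [A j].
    What follows the loop fails with a probability [f] that depends on the memory found there; the
    loop averages [f] over the draws. *)
Lemma good_for (Inv : nat -> (nat -> nat) -> Prop) A a r e q t N T
    (f : (nat -> nat) -> R) k s :
  (0 < w)%N -> (r < nvars)%N -> fits L w nvars e s ->
  eval L e s = N -> (N < 2 ^ w)%N -> Inv N (memory s) ->
  (forall m j x, Inv j.+1 m -> (j < N)%N -> x \in A j ->
     Inv j [eta m with a j |-> x]) ->
  (forall j s' k T (g : nat -> R), (j < N)%N -> regs s' r = j ->
     (forall x, (x < r)%N -> regs s' x = regs s x) ->
     (forall x s'', x \in A j -> memory s'' = [eta memory s' with a j |-> x] ->
        (forall x, (x <= r)%N -> regs s'' x = regs s' x) ->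
        good T (g x) (k, s'')) ->
     good (t + T) (mean (A j) g) (q :: k, s')) ->
  (forall s', Inv 0%N (memory s') ->
     (forall x, (x < r)%N -> regs s' x = regs s x) ->
     good T (f (memory s')) (k, s')) ->
  good (for_time r e N t + T) (avg A a N f (memory s))
    (for_down r e q :: k, s).
Proof.
move=> w0 rv fe <- {N} ew I0 wr body H.
rewrite /for_time addSn; apply: good_seq; rewrite -addnA.
apply: (good_runs (Q := fun s' => [/\ memory s' = memory s,
  regs s' r = eval L e s & forall x, (x < r)%N -> regs s' x = regs s x])).
  apply: runs_assign => // s' m' r' x'; split=> // x xr.
  by apply: x'; [exact: ltn_trans rv | rewrite ltn_eqF].
move=> s0 [m0 r0 x0]; rewrite -m0 in I0 *.
have := leqnn (eval L e s); move: {m0} r0 x0 I0.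
(* The induction is on the remaining iterations; the occurrence left alone bounds them by the
   initial count, which is known to fit in a word. *)
move: {1 2 3 5 6}(eval L e s) => N.
elim: N s0 => [|N IH] s0 r0 x0 I0 NN.
  apply: (good_reach (c' := (k, s0))); last exact: H.
  by apply: reach_step; rewrite step_while r0.
have -> : ((N.+1 * (decr_len r + t).+2).+1 + T = 1 +
    (decr_len r + (t + ((N * (decr_len r + t).+2).+1 + T))).+1)%N by lia.
apply: (@good_reach 1); first by apply: reach_step; rewrite step_while r0.
apply: good_seq.
apply: (good_runs (Q := fun s' => [/\ memory s' = memory s0,
  regs s' r = N & forall x, (x < r)%N -> regs s' x = regs s0 x])).
  have one : (1 < 2 ^ w)%N by rewrite -{1}(expn0 2) ltn_exp2l.
  have Nw : (N.+1 < 2 ^ w)%N by exact: leq_ltn_trans ew.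
  apply: runs_assign => //=.
  - by rewrite r0 subn1; do !split=> //; exact: ltnW.
  - by rewrite r0 subn1; exact: ltnW.
  move=> s' m' r' x'; split=> // [|x xr]; first by rewrite r' r0 subn1.
  by apply: x'; [exact: ltn_trans rv | rewrite ltn_eqF].
move=> s1 [m1 r1 x1]; apply: body => // [x xr|x s2 xA m2 x2].
  by rewrite x1 // x0.
rewrite -m1 -m2; apply: IH => //.
- by rewrite x2.
- by move=> y yr; rewrite x2 ?x1 ?x0 // ltnW.
- by rewrite m2 m1; exact: wr.
- exact: ltnW.
Qed.

End RandomRuns.

(** * The spanner encoded by a memory *)

(** Replacing every edge of a walk in [G] by a detour of at most three edges of [H] at most triples
    its length. *)
Lemma spannerI (R : realType) n (G H : sgraph n) : subrel H G ->
  (forall u v, G u v -> exists p, [/\ path H u p, last u p = v & (size p <= 3)%N]) ->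
  spanner R 3 G H.
Proof.
move=> HG short; split=> // s t.
(* With the factor 3 moved to the left, the right side is a bare infimum and each walk of [G] can be
   treated separately. *)
rewrite -lee_pdivrMl ?ltr0n //; apply: le_ereal_inf_tmp => _ [p [Gp <- ->]].
rewrite lee_pdivrMl ?ltr0n // -EFinM -natrM.
have [q [Hq lq sq]] : exists q,
    [/\ path H s q, last s q = last s p & (size q <= 3 * size p)%N].
  elim: p s Gp => [|x p IH] s /=; first by exists [::].
  move=> /andP [/short [q1 [H1 l1 s1]] /IH [q2 [H2 l2 s2]]].
  exists (q1 ++ q2); rewrite cat_path last_cat size_cat l1 H1 H2 l2; split=> //.
  by rewrite mulnS leq_add.
apply: (@le_trans _ _ (size q)%:R%:E); last by rewrite lee_fin ler_nat.
by apply: ereal_inf_lbound; exists q.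
Qed.

Section Spanner.
Local Open Scope nat_scope.
Variables (n : nat) (G : sgraph n) (L : adjlist G).

Lemma adj_wordsE (u v : 'I_n) : adj_words G u v = G u v.
Proof. by rewrite /adj_words !valK. Qed.

Lemma adj_wordsP x y :
  adj_words G x y -> exists u v : 'I_n, [/\ x = u, y = v & G u v].
Proof.
rewrite /adj_words; case: insubP => [u _ <-|//]; case: insubP => [v _ <-|//] uv.
by exists u, v.
Qed.

Lemma nbr_wordsE (u : 'I_n) : nbr_words L u = [seq val v | v <- L u].
Proof. by rewrite /nbr_words valK. Qed.

Lemma mem_nbr_words x y : y \in nbr_words L x -> adj_words G x y.
Proof.
rewrite /nbr_words; case: insubP => [u _ <-|//] /mapP [v]; rewrite nbrs_mem => uv ->.
by rewrite adj_wordsE.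
Qed.

Lemma count_nbr_words (u : 'I_n) (B : pred nat) :
  count B (nbr_words L u) = #|[set v : 'I_n | G u v && B v]|.
Proof.
rewrite nbr_wordsE count_map -size_filter cardE.
apply/perm_size/uniq_perm => [||v].
- by apply: filter_uniq; exact: nbrs_uniq.
- exact: enum_uniq.
by rewrite mem_filter mem_enum nbrs_mem andbC !inE.
Qed.

Definition deg (x : nat) : nat := size (nbr_words L x).

Lemma degE (u : 'I_n) : deg u = #|[set v : 'I_n | G u v]|.
Proof.
rewrite /deg -(count_predT (nbr_words L u)) count_nbr_words.
by congr #|pred_of_set _|; apply/setP => v; rewrite !inE andbT.
Qed.

Lemma deg_le x : deg x <= n.
Proof.
rewrite /deg /nbr_words; case: insubP => [u _ _|//].
by rewrite size_map -(card_uniqP (nbrs_uniq L u)) -[leqRHS]card_ord max_card.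
Qed.

(** [center m v] is one more than the name of the center of [v], or 0;
    [hit m u c] is one more than the name of a selected neighbor of [u] in the
    cluster of the center [c.-1], or 0. *)
Definition center_addr (v : nat) : nat := 4 * v + 2.
(** Rows have [n.+1] entries because [c] ranges over 0, ..., n. *)
Definition hit_addr (u c : nat) : nat := 4 * (u * n.+1 + c) + 3.
Lemma hit_index_lt u c : u < n -> c <= n -> u * n.+1 + c < n.+1 * n.+1.
Proof. by nia. Qed.

Definition center (m : nat -> nat) (v : nat) : nat := m (center_addr v).
Definition hit (m : nat -> nat) (u c : nat) : nat := m (hit_addr u c).

(** If [v] has no center, column 0 of [hit] is consulted. It is empty in a sound memory, so the
    third disjunct keeps every edge from [u] to an uncentered vertex of at least its degree. *)
Definition keep (m : nat -> nat) (u v : nat) : bool :=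
  [|| center m u == v.+1, hit m u (center m v) == v.+1 |
      (deg u <= deg v) && (hit m u (center m v) == 0)].

Definition kept_rel (m : nat -> nat) : rel 'I_n :=
  fun u v => G u v && (keep m u v || keep m v u).

Lemma kept_sym m : symmetric (kept_rel m).
Proof. by move=> u v; rewrite /kept_rel adj_sym orbC. Qed.

Lemma kept_irr m : irreflexive (kept_rel m).
Proof. by move=> u; rewrite /kept_rel adj_irr. Qed.

Definition kept (m : nat -> nat) : sgraph n := SGraph (kept_sym m) (kept_irr m).

(** Holds for every outcome of the draws, which makes the stretch bound deterministic. The clause
    [c != 0] says that uncentered vertices form no cluster. *)
Definition sound (m : nat -> nat) : Prop :=
  (forall v, v < n -> center m v != 0 -> adj_words G v (center m v).-1) /\
  (forall u c, u < n -> c <= n -> hit m u c != 0 ->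
     [/\ c != 0, adj_words G u (hit m u c).-1 &
         center m (hit m u c).-1 = c]).

(** If [uv] is discarded and [deg u <= deg v], then [u] has a selected neighbor
    in the cluster of [v], which gives a detour through the center of [v]. *)
Lemma kept_spanner (R : realType) m : sound m -> spanner R 3 G (kept m).
Proof.
move=> [csound hsound]; apply: spannerI => [u v /andP [] //|u v].
have star (a b : 'I_n) : center m a = b.+1 -> kept m a b.
  move=> e; apply/andP; split; last by rewrite /keep e eqxx.
  by have := csound _ (ltn_ord a); rewrite e adj_wordsE => ->.
(* [c] is the selected neighbor of [a] in the cluster of [b], and [d] is the common center of [b]
   and [c]. *)
have detour (a b : 'I_n) : G a b -> deg a <= deg b -> ~~ keep m a b ->
    exists c d : 'I_n, [/\ kept m a c, kept m c d & kept m b d].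
  move=> ab dab; rewrite /keep !negb_or dab /= => /and3P [_ _ nh].
  have cb : center m b <= n.
    have [->//|/(csound _ (ltn_ord b))] := eqVneq (center m b) 0.
    by move=> /adj_wordsP [_ [d [_ e _]]]; have := ltn_ord d; lia.
  have [c0 /adj_wordsP [_ [c [/val_inj <- hc ac]]] cc] := hsound _ _ (ltn_ord a) cb nh.
  rewrite hc in cc.
  have [_ [d [_ bd _]]] := adj_wordsP (csound _ (ltn_ord b) c0).
  have cbd : center m b = d.+1 by lia.
  exists c, d; split; [|by apply: star; rewrite cc|exact: star].
  apply/andP; split=> //; rewrite /keep cc.
  have -> : hit m a (center m b) == c.+1 by apply/eqP; lia.
  by rewrite orbT.
move=> uv; have [|] := boolP (kept m u v); first by exists [:: v]; rewrite /= andbT.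
rewrite /= /kept_rel uv /= negb_or => /andP [kuv kvu].
have sym a b : kept m a b = kept m b a by exact: kept_sym.
have [duv|/ltnW dvu] := leqP (deg u) (deg v).
  have [c [d [uc cd vd]]] := detour _ _ uv duv kuv.
  by rewrite sym in vd; exists [:: c; d; v]; split=> //; apply/and4P.
rewrite adj_sym in uv; have [c [d [vc cd ud]]] := detour _ _ uv dvu kvu.
rewrite sym in cd; rewrite sym in vc.
by exists [:: d; c; v]; split=> //; apply/and4P.
Qed.

(** * Size of the spanner *)

Variables (S X : nat -> nat) (r l : nat).
Hypotheses (n_le : n <= r * r) (r_gt0 : 0 < r) (l_gt0 : 0 < l).
(** With [r] about sqrt n and [l] about log n, the factor 5 leaves room for [4 * l * r + 1] ranks
    and makes a cluster holding a fraction 1/r of the neighbors be missed with probability at most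
    [exp (- 5 l)]. *)
Let K := 5 * l * r.

(** In a right fold the earliest draw wins, as it does in a loop that runs through the draws
    backwards and overwrites. *)
Definition first_center (s : seq nat) (v : nat) : nat :=
  foldr (fun i c => if adj_words G v (S i) then (S i).+1 else c) 0 s.

Lemma first_centerP s v : has (fun i => adj_words G v (S i)) s ->
  exists2 i, i \in s & first_center s v = (S i).+1.
Proof.
elim: s => //= i s IH; case: ifP => [_ _|_ /IH [j js ->]].
  by exists i => //; rewrite inE eqxx.
by exists j => //; rewrite inE js orbT.
Qed.

Lemma first_center_sub s1 s2 v : has (fun i => adj_words G v (S i)) s1 ->
  first_center (s1 ++ s2) v = first_center s1 v.
Proof. by elim: s1 => //= i s IH; case: ifP. Qed.

Lemma first_center_neq0 s v : first_center s v != 0 ->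
  exists2 i, i \in s & first_center s v = (S i).+1 /\ adj_words G v (S i).
Proof.
elim: s => //= i s IH; case: ifP => [a _|_ /IH [j js ?]].
  by exists i => //; rewrite inE eqxx.
by exists j => //; rewrite inE js orbT.
Qed.

(** With high probability, a vertex of degree [d] has its center among the first
    [rank d] draws. *)
Definition rank (d : nat) : nat := (4 * l * n %/ d).+1.

Lemma rank_le d : r < d -> rank d <= K.
Proof.
move=> rd; have d0 : 0 < d by lia.
rewrite /rank /K; have : 4 * l * n %/ d <= 4 * l * r.
  rewrite -ltnS ltn_divLR //; nia.
by nia.
Qed.

Definition all_centered : Prop := forall v : 'I_n, r < deg v ->
  has (fun i => adj_words G v (S i)) (iota 0 (rank (deg v))).

(** The cluster of [c] holds a fraction at least 1/r of the neighbors of [u]. It is expressed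
    through [first_center], hence depends on the draws [S] only and not on the final memory. *)
Definition heavy (u c : 'I_n) : bool :=
  (0 < deg u) &&
  (deg u <= r * count (fun x => first_center (iota 0 K) x == c.+1) (nbr_words L u)).

Definition all_sampled : Prop := forall u c : 'I_n, heavy u c ->
  has (fun j => first_center (iota 0 K) (X (u * K + j)) == c.+1) (iota 0 K).

Variable m : nat -> nat.
Hypothesis S_lt : forall i, S i < n.
Hypothesis X_nbr : forall j, j < n * K -> 0 < deg (j %/ K) -> X j \in nbr_words L (j %/ K).
Hypothesis centerE : forall v, v < n -> center m v = first_center (iota 0 K) v.
Hypothesis hit_sampled : forall j, j < n * K -> adj_words G (j %/ K) (X j) ->
  center m (X j) != 0 -> hit m (j %/ K) (center m (X j)) != 0.

(** A larger set would make the cluster heavy, hence sampled at [u]; then [u] has a selected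
    neighbor for it and the set is empty. *)
Lemma card_cluster (u c : 'I_n) : all_sampled -> 0 < deg u ->
  #|[set v : 'I_n | G u v && (center m v == c.+1) && (hit m u (center m v) == 0)]| * r
  <= deg u.
Proof.
move=> samp d0; set D := [set v | _]; rewrite leqNgt; apply/negP => big.
have K0 : 0 < K by rewrite /K !muln_gt0 l_gt0 r_gt0.
have /samp /hasP [j] : heavy u c.
  rewrite /heavy d0 count_nbr_words mulnC (leq_trans (ltnW big)) // leq_mul2r.
  apply/orP; right; apply/subset_leq_card/fintype.subsetP => v; rewrite !inE.
  by rewrite centerE // => /andP [].
rewrite mem_iota add0n => /andP [_ jK] /eqP e.
have ju : (u * K + j) %/ K = u by rewrite divnMDl // divn_small // addn0.
have jn : u * K + j < n * K by have := ltn_ord u; nia.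
have := X_nbr jn; rewrite ju => /(_ d0) /mem_nbr_words ax.
have [_ [x [_ xX _]]] := adj_wordsP ax.
have cx : center m (X (u * K + j)) = c.+1 by rewrite xX centerE // -xX.
have nh := hit_sampled jn; rewrite ju cx ax in nh.
suff D0 : D = finset.set0 by rewrite D0 cards0 in big.
apply/setP => v; rewrite !inE; apply/negP => /andP [/andP [_ /eqP ->]].
by apply/negP; exact: nh.
Qed.

(** For [deg u <= r] all neighbors together are few enough. Otherwise the other ends have their
    centers among the first [I = rank (deg u)] draws, each cluster contributes at most [deg u / r],
    and [I * deg u <= 4 l n + deg u <= K * r]. *)
Lemma card_unhit (u : 'I_n) : all_centered -> all_sampled ->
  #|[set v : 'I_n | G u v && ((deg u <= deg v) && (hit m u (center m v) == 0))]| <= K.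
Proof.
move=> cent samp; set D := [set v | _].
have [dr|rd] := leqP (deg u) r.
  apply: (@leq_trans (deg u)); last by rewrite /K; nia.
  rewrite degE; apply/subset_leq_card/fintype.subsetP => v; rewrite !inE.
  by case/andP.
have d0 : 0 < deg u by lia.
pose I := rank (deg u).
pose F (i : 'I_I) := [set v : 'I_n |
  G u v && (center m v == (S i).+1) && (hit m u (center m v) == 0)].
have DF : D \subset \bigcup_i F i.
  apply/fintype.subsetP => v; rewrite inE => /andP [uv /andP [dv hv]].
  have rv : r < deg v by lia.
  have le_rank : rank (deg v) <= I by rewrite /I /rank ltnS leq_div2l.
  have [i] := first_centerP (cent v rv).
  rewrite mem_iota add0n => /andP [_ iI] e.
  apply/bigcupP; exists (Ordinal (leq_trans iI le_rank)) => //.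
  rewrite inE uv hv andbT centerE //=.
  have -> : iota 0 K = iota 0 (rank (deg v)) ++ iota (rank (deg v)) (K - rank (deg v)).
    by rewrite -{2}[rank _]add0n -iotaD subnKC // rank_le.
  by rewrite first_center_sub ?e //; exact: cent.
have : #|D| * r <= I * deg u.
  apply: (@leq_trans ((\sum_i #|F i|) * r)).
    rewrite leq_mul2r; apply/orP; right.
    apply: leq_trans (subset_leq_card DF) _.
    elim/big_rec2: _ => [|i x y _ IH]; first by rewrite cards0.
    by apply: leq_trans (leq_card_setU _ _) _; rewrite leq_add2l.
  rewrite big_distrl /= -[I in leqRHS]card_ord -sum_nat_const.
  apply: leq_sum => i _; exact: (card_cluster (Ordinal (S_lt i))).
have : I * deg u <= 4 * l * n + deg u.
  by rewrite /I /rank mulSn addnC leq_add2r leq_trunc_div.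
have := deg_le u; rewrite /K; nia.
Qed.

(** Such a [v] is determined by its center through [hit m u], and there are at most [K] centers. *)
Lemma card_hit_eq (u : 'I_n) :
  #|[set v : 'I_n | (hit m u (center m v) == v.+1) && (center m v != 0)]| <= K.
Proof.
set D := [set v | _].
have : {subset [seq center m v | v : 'I_n in D] <= [seq (S i).+1 | i <- iota 0 K]}.
  move=> x /mapP [v]; rewrite mem_enum inE => /andP [_ c0] ->.
  move: c0; rewrite centerE // => /first_center_neq0 [i iK [-> _]].
  exact: map_f.
move=> /uniq_leq_size; rewrite !size_map size_iota -cardE; apply.
rewrite map_inj_in_uniq ?enum_uniq // => v v'; rewrite !mem_enum !inE.
move=> /andP [/eqP e _] /andP [/eqP e' _] ec; apply: val_inj.
by rewrite ec e' in e; case: e.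
Qed.

Hypothesis hit0 : forall u, u < n -> hit m u 0 = 0.

Lemma card_keep (u : 'I_n) : all_centered -> all_sampled ->
  #|[set v : 'I_n | G u v && keep m u v]| <= 1 + K + K.
Proof.
move=> cent samp.
pose D1 := [set v : 'I_n | center m u == v.+1].
pose D2 := [set v : 'I_n | (hit m u (center m v) == v.+1) && (center m v != 0)].
pose D3 := [set v : 'I_n |
  G u v && ((deg u <= deg v) && (hit m u (center m v) == 0))].
apply: (@leq_trans #|D1 :|: D2 :|: D3|).
  apply/subset_leq_card/fintype.subsetP => v; rewrite !inE => /andP [uv].
  case/or3P => [->//|e|->]; last by rewrite uv orbT.
  rewrite e /=; have [c0|_] := eqVneq (center m v) 0; last by rewrite !orbT.
  by rewrite c0 hit0 // in e.
apply: leq_trans (leq_card_setU _ _) _; apply: leq_add; last exact: card_unhit.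
apply: leq_trans (leq_card_setU _ _) _; apply: leq_add; last exact: card_hit_eq.
have D1E (v v' : 'I_n) : v \in D1 -> v' \in D1 -> v = v'.
  by rewrite !inE => /eqP -> /eqP [] /val_inj.
have [->|[v vD]] := set_0Vmem D1; first by rewrite cards0.
rewrite -(cards1 v); apply/subset_leq_card/fintype.subsetP => v' /D1E.
by move=> /(_ _ vD) ->; rewrite inE.
Qed.

(** The factor 2 arises because an edge may be kept on account of either end. *)
Lemma num_edges_kept : all_centered -> all_sampled ->
  num_edges (kept m) <= 2 * (n * (1 + K + K)).
Proof.
move=> cent samp.
pose A := [set e : 'I_n * 'I_n | G e.1 e.2 && keep m e.1 e.2].
pose sw (e : 'I_n * 'I_n) := (e.2, e.1).
have cA : #|A| <= n * (1 + K + K).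
  have -> : #|A| = \sum_(u : 'I_n) #|[set v : 'I_n | G u v && keep m u v]|.
    transitivity (\sum_(u : 'I_n) \sum_(v : 'I_n | G u v && keep m u v) 1).
      by rewrite pair_big_dep -sum1_card; apply: eq_bigl => -[u v]; rewrite inE.
    by apply: eq_bigr => u _; rewrite sum1dep_card.
  rewrite -[n in leqRHS]card_ord -sum_nat_const; apply: leq_sum => u _.
  exact: card_keep.
apply: (@leq_trans #|A :|: sw @^-1: A|).
  apply/subset_leq_card/fintype.subsetP => -[u v]; rewrite !inE /= => /and3P [_ uv].
  by rewrite (adj_sym G v) uv.
apply: leq_trans (leq_card_setU _ _) _; rewrite mul2n -addnn leq_add //.
have swK : involutive sw by case.
by rewrite on_card_preimset //; exists sw => ? _; rewrite swK.
Qed.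

End Spanner.

(** * Failure probability *)

Section Failure.
Variables (R : realType) (n : nat) (G : sgraph n) (L : adjlist G) (r l : nat).
Hypotheses (n_gt1 : (1 < n)%N) (n_le : (n <= r * r)%N) (r_gt0 : (0 < r)%N).
Hypotheses (l_gt0 : (0 < l)%N) (n_lt : (n < 2 ^ l)%N).
Let K := (5 * l * r)%N.

(** Residues modulo 4 keep the four tables disjoint: drawn vertices, sampled neighbors, centers,
    selected neighbors. *)
Definition S_addr (i : nat) : nat := (4 * i)%N.
Definition X_addr (j : nat) : nat := (4 * j + 1)%N.
Definition S_tape (m : nat -> nat) (i : nat) : nat := m (S_addr i).
Definition X_tape (m : nat -> nat) (j : nat) : nat := m (X_addr j).

Definition S_dist : nat -> seq nat := fun=> iota 0 (maxn 1 n).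
(** The cell [j] belongs to the vertex [j %/ k]. The value 0 at a vertex without neighbors is what
    [IRandNbr] returns. *)
Definition X_dist (k j : nat) : seq nat :=
  if nbr_words L (j %/ k) is [::] then [:: 0%N] else nbr_words L (j %/ k).

Definition tape_good (m : nat -> nat) : Prop :=
  all_centered L (S_tape m) r l /\ all_sampled L (S_tape m) (X_tape m) r l.

Definition tape_bad (m : nat -> nat) : R := (~~ `[< tape_good m >])%:R.

Lemma X_dist_neq0 k j : X_dist k j != [::].
Proof. by rewrite /X_dist; case e: (nbr_words _ _). Qed.

Lemma S_dist_neq0 j : S_dist j != [::].
Proof. by rewrite /S_dist -size_eq0 size_iota -lt0n leq_max. Qed.

Let K_gt0 : (0 < K)%N. Proof. by rewrite /K !muln_gt0 l_gt0 r_gt0. Qed.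

Lemma exprn_le_expR (x : R) k : 0 <= 1 - x -> (1 - x) ^+ k <= expR (- (x * k%:R)).
Proof.
move=> x0; rewrite -mulNr mulrC expRM_natl; apply: lerXn2r; rewrite ?nnegrE ?expR_ge0 //.
exact: expR_ge1Dx.
Qed.

Lemma expRN_le_inv : expR (- l%:R) <= n%:R^-1 :> R.
Proof.
have n0 : (0 : R) < n%:R by rewrite ltr0n; lia.
rewrite expRN lef_pV2 ?posrE ?expR_gt0 //.
apply: (@le_trans _ _ (2 ^+ l)); first by rewrite -natrX ler_nat ltnW.
rewrite -[l%:R]mul1r mulrC expRM_natl lerXn2r ?nnegrE ?expR_ge0 ?ler0n //.
by have := expR_ge1Dx (1 : R); rewrite -[1 + 1]/2.
Qed.

Definition missed_center (m : nat -> nat) (v : 'I_n) : R :=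
  ((r < deg L v)%N && all (fun i => (i < rank n l (deg L v))%N ==>
     ~~ adj_words G v (m (S_addr i))) (iota 0 K))%:R.

(** Clusters are read from [m0] and samples from [m], so that the samples can be averaged while the
    clusters stay fixed. *)
Definition missed_sample (m0 m : nat -> nat) (uc : 'I_n * 'I_n) : R :=
  (heavy L (S_tape m0) r l uc.1 uc.2 && all (fun j => (j %/ K == uc.1)%N ==>
     ~~ (first_center G (S_tape m0) (iota 0 K) (m (X_addr j)) == uc.2.+1))
     (iota 0 (n * K)))%:R.

Lemma tape_bad_le m : tape_bad m <=
  \sum_v missed_center m v + \sum_uc missed_sample m m uc.
Proof.
have c0 v : 0 <= missed_center m v by rewrite /missed_center.
have s0 uc : 0 <= missed_sample m m uc by rewrite /missed_sample.
have sc0 : 0 <= \sum_v missed_center m v by exact: sumr_ge0.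
have ss0 : 0 <= \sum_uc missed_sample m m uc by exact: sumr_ge0.
rewrite /tape_bad; case: asboolP => [_|bad] /=; first exact: addr_ge0.
have [cent|ncent] := pselect (all_centered L (S_tape m) r l).
  have nsamp : ~ all_sampled L (S_tape m) (X_tape m) r l by move=> ?; apply: bad.
  have [u /existsNP [c /not_implyP [hv /negP nh]]] : exists u, ~ forall c, heavy L (S_tape m) r l u c ->
    has (fun j => first_center G (S_tape m) (iota 0 K) (X_tape m (u * K + j)) == c.+1) (iota 0 K).
    by apply/existsNP.
  apply: ler_wpDl => //; rewrite (bigD1 (u, c)) //=.
  apply: ler_wpDr; first exact: sumr_ge0.
  rewrite /missed_sample hv ler_nat /= lt0b.
  apply/allP => j _; apply/implyP => /eqP ju; apply: contra nh => h.
  apply/hasP; exists (j %% K)%N; first by rewrite mem_iota add0n ltn_mod K_gt0.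
  by rewrite -ju -divn_eq.
have /existsNP [v /not_implyP [dv /negP nh]] := ncent.
apply: ler_wpDr => //; rewrite (bigD1 v) //=.
apply: ler_wpDr; first exact: sumr_ge0.
rewrite /missed_center dv ler_nat /= lt0b.
apply/allP => i _; apply/implyP => iv; apply: contra nh => h.
by apply/hasP; exists i => //; rewrite mem_iota.
Qed.

(** A draw misses the [d] neighbors of [v] with probability [1 - d / n], and the rank is rounded up
    so that [rank d * d >= 4 l n]. *)
Lemma avg_missed_center v m :
  avg S_dist S_addr K (fun m => missed_center m v) m <= expR (- (4 * l)%:R).
Proof.
have [rd|dr] := ltnP r (deg L v); last first.
  under [X in avg _ _ _ X]eq_fun do rewrite /missed_center ltnNge dr /=.
  by rewrite avg_const ?expR_ge0 //; exact: S_dist_neq0.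
under [X in avg _ _ _ X]eq_fun do rewrite /missed_center rd andTb.
have n0 : (0 : R) < n%:R by rewrite ltr0n; lia.
have dn : (deg L v)%:R / n%:R <= 1 :> R by rewrite ler_pdivrMr // mul1r ler_nat deg_le.
have d0 : (0 : R) <= (deg L v)%:R / n%:R by rewrite divr_ge0.
have rK : (rank n l (deg L v) <= K)%N by exact: rank_le.
apply: le_trans (@avg_avoid R _ _ (fun i => (i < rank n l (deg L v))%N)
  (adj_words G v) (1 - (deg L v)%:R / n%:R) _ _ _ _ _ _) _.
- by move=> i j _ _; rewrite /S_addr; lia.
- exact: S_dist_neq0.
- by rewrite subr_ge0.
- move=> j _; rewrite /S_dist (maxn_idPr (ltnW n_gt1)) size_iota.
  rewrite mulrBl mul1r divfK ?gt_eqF // lerBrDr -natrD ler_nat.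
  have -> : deg L v = count (adj_words G v) (iota 0 n).
    rewrite -val_enum_ord count_map degE -size_filter cardE.
    apply/perm_size/uniq_perm => [||u]; first exact: enum_uniq.
      by apply: filter_uniq; exact: enum_uniq.
    by rewrite mem_enum [RHS]mem_filter mem_enum !inE andbT /= adj_wordsE.
  by rewrite addnC count_predC size_iota.
have -> : count (fun i => (i < rank n l (deg L v))%N) (iota 0 K) = rank n l (deg L v).
  rewrite -(subnKC rK) iotaD count_cat add0n.
  rewrite [X in (X + _)%N](eq_in_count (a2 := xpredT)); last first.
    by move=> i; rewrite mem_iota.
  rewrite [X in (_ + X)%N](eq_in_count (a2 := xpred0)); last first.
    by move=> i; rewrite mem_iota /= => /andP [? _]; apply/negbTE; lia.
  by rewrite count_predT count_pred0 size_iota addn0.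
apply: le_trans (exprn_le_expR _ _) _; first by rewrite subr_ge0.
rewrite ler_expR lerN2 mulrAC ler_pdivlMr // -!natrM ler_nat /rank.
have dd : (0 < deg L v)%N by lia.
by have := ltn_ceil (4 * l * n) dd; lia.
Qed.

(** A sample at [u] misses a heavy cluster with probability at most [1 - 1 / r], and [u] has
    [K = 5 l r] samples. *)
Lemma avg_missed_sample m0 uc m :
  avg (X_dist K) X_addr (n * K) (fun m => missed_sample m0 m uc) m
  <= expR (- (5 * l)%:R).
Proof.
case: uc => u c.
have [hv|nhv] := boolP (heavy L (S_tape m0) r l u c); last first.
  under [X in avg _ _ _ X]eq_fun do rewrite /missed_sample /= (negPf nhv) /=.
  by rewrite avg_const ?expR_ge0 //; exact: X_dist_neq0.
under [X in avg _ _ _ X]eq_fun do rewrite /missed_sample /= hv andTb.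
have r0 : (0 : R) < r%:R by rewrite ltr0n.
have p0 : (0 : R) <= 1 - r%:R^-1 by rewrite subr_ge0 invf_le1 // ler1n.
apply: le_trans (@avg_avoid R _ _ (fun j => j %/ K == u)%N
  (fun x => first_center G (S_tape m0) (iota 0 K) x == c.+1) (1 - r%:R^-1) _ _ _ _ _ _) _.
- by move=> i j _ _; rewrite /X_addr; lia.
- exact: X_dist_neq0.
- by [].
- move=> j /eqP ju; rewrite /X_dist ju.
  case/andP: hv; rewrite /deg; case e: (nbr_words L u) => [//|x s] _ hv.
  rewrite -e in hv *; set B := fun x => _.
  rewrite mulrBl mul1r lerBrDr.
  rewrite -[in leRHS](count_predC B (nbr_words L u)) addrC natrD lerD2r.
  by rewrite ler_pdivrMl // -natrM ler_nat.
have cK : (K <= count (fun j => j %/ K == u)%N (iota 0 (n * K)))%N.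
  have un := ltn_ord u.
  have -> : (n * K = u * K + (K + (n - u.+1) * K))%N by nia.
  rewrite !iotaD !count_cat add0n addnCA; apply: leq_trans (leq_addr _ _).
  rewrite (eq_in_count (a2 := xpredT)) ?count_predT ?size_iota // => j.
  rewrite mem_iota => /andP [uj ju]; apply/eqP.
  by apply/eqP; rewrite eqn_leq leq_divRL // uj andbT -ltnS ltn_divLR // mulSn addnC.
have p1 : 1 - r%:R^-1 <= 1 :> R by rewrite lerBlDr lerDl invr_ge0.
apply: le_trans (ler_wiXn2l p0 p1 cK) _.
apply: le_trans (exprn_le_expR _ _) _ => //.
by rewrite ler_expR lerN2 ler_pdivlMl // -natrM ler_nat mulnC.
Qed.

(** Union bound over n vertices and n^2 pairs: since [exp (- l) <= 1 / n], the total is at most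
    [n / n^4 + n^2 / n^5 = 2 / n^3]. *)
Lemma avg_tape_bad m : avg S_dist S_addr K
  (avg (X_dist K) X_addr (n * K) tape_bad) m <= n%:R^-1.
Proof.
have n0 : (0 : R) < n%:R by rewrite ltr0n; lia.
pose p2 : R := \sum_(uc : 'I_n * 'I_n) expR (- (5 * l)%:R).
(* Sampling neighbors does not touch the cells of [S_tape], so the first sum is a constant of the
   inner average. *)
have step1 m1 : avg (X_dist K) X_addr (n * K) tape_bad m1 <=
    \sum_v missed_center m1 v + p2.
  apply: (@le_trans _ _ (avg (X_dist K) X_addr (n * K) (fun m2 =>
      \sum_v missed_center m1 v + \sum_uc missed_sample m1 m2 uc) m1)).
    apply: (@ler_avg _ _ _ (fun m2 => S_tape m2 = S_tape m1)) => //.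
    - move=> m2 j x _ _ <-; apply/funext => i; rewrite /S_tape /S_addr /X_addr /=.
      by case: eqP => //; lia.
    - move=> m2 e; apply: le_trans (tape_bad_le m2) _.
      rewrite /missed_sample e lerD2r; apply: ler_sum => v _.
      rewrite /missed_center le_eqVlt; apply/orP; left; apply/eqP.
      congr (_ && _)%:R; apply: eq_all => i.
      by rewrite -[m2 _]/(S_tape m2 i) e.
  rewrite avgD avg_const; last exact: X_dist_neq0.
  rewrite lerD2l avg_sum; apply: ler_sum => uc _; exact: avg_missed_sample.
apply: (@le_trans _ _ (avg S_dist S_addr K
    (fun m1 => \sum_v missed_center m1 v + p2) m)).
  by apply: (@ler_avg _ _ _ (fun=> True)).
rewrite avgD avg_const; last exact: S_dist_neq0.
rewrite avg_sum.
apply: (@le_trans _ _ ((\sum_(v : 'I_n) expR (- (4 * l)%:R)) + p2)).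
  by rewrite lerD2r; apply: ler_sum => v _; exact: avg_missed_center.
rewrite /p2 !sumr_const card_prod !card_ord !natrM -!mulrN !expRM_natl.
set x := expR _.
rewrite -[x ^+ 4 *+ _]mulr_natl -[x ^+ 5 *+ _]mulr_natl natrM.
have x0 : 0 <= x by exact: expR_ge0.
have xn : x <= n%:R^-1 by exact: expRN_le_inv.
apply: (@le_trans _ _ (n%:R * n%:R^-1 ^+ 4 + n%:R * n%:R * n%:R^-1 ^+ 5)).
  by apply: lerD; apply: ler_wpM2l; rewrite ?mulr_ge0 // lerXn2r ?nnegrE ?invr_ge0.
have -> : n%:R * n%:R^-1 ^+ 4 + n%:R * n%:R * n%:R^-1 ^+ 5 =
  (2 / n%:R) * (n%:R^-1 * n%:R^-1) :> R by field; rewrite gt_eqF.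
apply: (@le_trans _ _ (1 * (1 * n%:R^-1))); last by rewrite !mul1r.
have n2 : (2 : R) <= n%:R by rewrite ler_nat.
apply: ler_pM => //; rewrite ?mulr_ge0 ?invr_ge0 //.
  by rewrite ler_pdivrMr // mul1r.
by apply: ler_wpM2r; rewrite ?invr_ge0 // invf_le1 //; lra.
Qed.

End Failure.

(** * The programs *)

Declare Scope expr_scope.
Delimit Scope expr_scope with X.
Bind Scope expr_scope with expr.
Arguments Bin o (a b)%_X.
Arguments Ld a%_X.
Arguments Deg a%_X.
Arguments Adj (a b)%_X.
Notation "x + y" := (Bin OAdd x y) : expr_scope.
Notation "x - y" := (Bin OSub x y) : expr_scope.
Notation "x * y" := (Bin OMul x y) : expr_scope.
Notation "x / y" := (Bin ODiv x y) : expr_scope.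
Notation "x %% y" := (Bin OMod x y) : expr_scope.
Notation "x < y" := (Bin OLt x y) : expr_scope.
Notation "x == y" := (Bin OEq x y) : expr_scope.
Arguments assign r%_N e%_X.
Arguments store a%_X e%_X.
Arguments for_down r%_N e%_X p.

(** A conditional without branching on a bit [b]: the loop bodies stay straight-line and their
    running time is [len]. *)
Definition select (b x y : expr) : expr := (b * x + (Cst 1 - b) * y)%X.
Arguments select (b x y)%_X.

Definition S_cell (i : expr) : expr := (Cst 4 * i)%X.
Definition X_cell (j : expr) : expr := (Cst 4 * j + Cst 1)%X.
Definition center_cell (v : expr) : expr := (Cst 4 * v + Cst 2)%X.
Definition hit_cell (u c : expr) : expr :=
  (Cst 4 * (u * (Var 0 + Cst 1) + c) + Cst 3)%X.

Definition size_body : prog :=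
  Seq (assign 3 (Var 3 + Cst 1))
  (Seq (assign 4 (Var 4 + Var 4))
       (assign 5 (Cst 1 - (Var 0 < Var 4 * Var 4)))).

(** Register 3 counts the doublings of register 4 until its square exceeds [n];
    register 1 receives the number of samples. *)
Definition size_prog : prog :=
  Seq (assign 4 (Cst 1))
  (Seq (assign 5 (Cst 1))
  (Seq (While 5 size_body)
       (assign 1 (Cst 10 * Var 3 * Var 4)))).

Definition S_body : prog :=
  Seq (Do (IRand 3 0)) (store (S_cell (Var 2)) (Var 3)).

Definition X_body : prog :=
  Seq (assign 4 (Var 2 / Var 1))
  (Seq (Do (IRandNbr 3 4)) (store (X_cell (Var 2)) (Var 3))).

(** The loop index encodes a pair of a vertex (quotient by [K]) and a draw (remainder). As it
    decreases, the smallest adjacent draw is written last. *)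
Definition center_body : prog :=
  Seq (assign 3 (Var 2 / Var 1))
  (Seq (assign 4 (Ld (S_cell (Var 2 %% Var 1)%X)))
       (store (center_cell (Var 3))
          (select (Adj (Var 3) (Var 4)) (Var 4 + Cst 1)
             (Ld (center_cell (Var 3)))))).

(** The adjacency test rejects the default sample 0 of an isolated vertex; the test [Cst 0 < Var 5]
    keeps column 0 empty. *)
Definition hit_body : prog :=
  Seq (assign 3 (Var 2 / Var 1))
  (Seq (assign 4 (Ld (X_cell (Var 2))))
  (Seq (assign 5 (Ld (center_cell (Var 4))))
       (store (hit_cell (Var 3) (Var 5))
          (select (Adj (Var 3) (Var 4) * (Cst 0 < Var 5)) (Var 4 + Cst 1)
             (Ld (hit_cell (Var 3) (Var 5))))))).

Definition construct : prog :=
  Seq size_prog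
  (Seq (for_down 2 (Var 1) S_body)
  (Seq (for_down 2 (Var 0 * Var 1) X_body)
  (Seq (for_down 2 (Var 0 * Var 1) center_body)
       (for_down 2 (Var 0 * Var 1) hit_body)))).

(** The disjunction of [keep] in both directions is a sum of bits compared with 0, and [a <= b] is
    encoded as [1 - (b < a)]. *)
Definition query : prog :=
  Seq (assign 3 (Ld (center_cell (Var 1))))
  (Seq (assign 4 (Ld (center_cell (Var 2))))
  (Seq (assign 5 (Ld (hit_cell (Var 1) (Var 4))))
  (Seq (assign 6 (Ld (hit_cell (Var 2) (Var 3))))
       (assign 0 (Adj (Var 1) (Var 2) * (Cst 0 <
          (Var 3 == Var 2 + Cst 1) + (Var 5 == Var 2 + Cst 1) +
          (Cst 1 - (Deg (Var 2) < Deg (Var 1))) * (Var 5 == Cst 0) +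
          (Var 4 == Var 1 + Cst 1) + (Var 6 == Var 1 + Cst 1) +
          (Cst 1 - (Deg (Var 1) < Deg (Var 2))) * (Var 6 == Cst 0))))))).

(** The number of iterations of the loop in [size_prog]. *)
Definition doublings (n : nat) : nat := (trunc_log 2 n)./2.+1.

(** This is [5 * l * r] for [r = 2 ^ doublings n], which exceeds sqrt n, and [l = 2 * doublings n],
    chosen so that [2 ^ l = r * r > n]. *)
Definition num_samples (n : nat) : nat :=
  (5 * (2 * doublings n) * 2 ^ doublings n)%N.

Lemma le_sqr_doublings n j : (0 < n)%N ->
  (2 ^ j * 2 ^ j <= n)%N = (j < doublings n)%N.
Proof.
move=> n0; rewrite -expnD addnn /doublings ltnS -[RHS]leq_double.
apply/idP/idP => [H|H].
  have := trunc_log_max (isT : 1 < 2)%N H.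
  by move=> /half_leq; rewrite doubleK leq_double.
apply: leq_trans (trunc_logP (isT : 1 < 2)%N n0); rewrite leq_exp2l //.
by apply: leq_trans H _; rewrite -[leqRHS]odd_double_half leq_addl.
Qed.

Lemma sqr_doublings_gt n : (0 < n)%N -> (n < 2 ^ doublings n * 2 ^ doublings n)%N.
Proof. by move=> n0; rewrite ltnNge le_sqr_doublings // ltnn. Qed.

Lemma sqr_doublings_le n : (0 < n)%N ->
  (2 ^ doublings n * 2 ^ doublings n <= 4 * n)%N.
Proof.
move=> n0; have : (2 ^ (doublings n).-1 * 2 ^ (doublings n).-1 <= n)%N.
  by rewrite le_sqr_doublings.
by rewrite /doublings /= !expnS; lia.
Qed.

(** A crude bound from [d < 2 ^ d], which suffices to make indices up to [n * K] fit in a word. *)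
Lemma num_samples_le n : (0 < n)%N -> (num_samples n <= 40 * n)%N.
Proof.
move=> n0; have := sqr_doublings_le n0; have := ltn_expl (doublings n) (isT : 1 < 2)%N.
by rewrite /num_samples; nia.
Qed.

Lemma num_samples_gt0 n : (0 < num_samples n)%N.
Proof. by rewrite /num_samples !muln_gt0 expn_gt0. Qed.

(** Addresses stay near [4 * n * K <= 160 * (n + 1) ^ 2], below the bound with 256. Of the ten
    factors [b > n], two cover [(n + 1) ^ 2] and eight cover 256. *)
Lemma word_size_bound n : (256 * (n.+1 * n.+1) <= 2 ^ word_size 10 n)%N.
Proof.
rewrite /word_size [X in (2 ^ X)%N]mulnC expnM; set b := (2 ^ _)%N.
have nb : (n < b)%N by exact: (trunc_log_ltn n (isT : 1 < 2)%N).
have b2 : (2 <= b)%N by rewrite /b expnS; have := expn_gt0 2 (trunc_log 2 n); lia.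
have -> : (b ^ 10 = b ^ 8 * (b * b))%N by rewrite mulnn -expnD.
by apply: leq_mul; [rewrite (leq_exp2r 2 b (isT : 0 < 8)%N) | exact: leq_mul].
Qed.

(** * Correctness of the programs *)

Section Correctness.
Local Open Scope nat_scope.
Variables (n : nat) (G : sgraph n) (L : adjlist G) (w : nat).
Hypothesis n_gt0 : 0 < n.
Hypothesis word_large : 256 * (n.+1 * n.+1) <= 2 ^ w.
Let K := num_samples n.

Let w_gt0 : 0 < w.
Proof. by case: w word_large => //; rewrite expn0; lia. Qed.

Let K_gt0 : 0 < K. Proof. exact: num_samples_gt0. Qed.

Let nK_le : n * K <= 40 * (n.+1 * n.+1).
Proof. by have := num_samples_le n_gt0; rewrite -/K; nia. Qed.

Let K_le : K <= 40 * (n.+1 * n.+1).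
Proof. by have := num_samples_le n_gt0; rewrite -/K; nia. Qed.

Let n_le_sqr : 2 * n + 1 <= n.+1 * n.+1.
Proof. by nia. Qed.

Lemma eval_select b x y (t : bool) s : eval L b s = t ->
  eval L (select b x y) s = if t then eval L x s else eval L y s.
Proof. by move=> /= ->; case: t; rewrite ?mul1n ?mul0n ?addn0. Qed.

Lemma fits_select b x y (t : bool) s : eval L b s = t ->
  fits L w nvars b s -> fits L w nvars x s -> fits L w nvars y s ->
  eval L x s < 2 ^ w -> eval L y s < 2 ^ w -> fits L w nvars (select b x y) s.
Proof.
move=> e fb fx fy xw yw /=; rewrite e.
by case: (t); rewrite ?mul1n ?mul0n ?addn0 ?subnn ?subn0 ?add0n ?mul1n ?mul0n;
  do ?[split=> //]; lia.
Qed.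

Definition size_time : nat :=
  (len (assign 4 (Cst 1)) + (len (assign 5 (Cst 1)) +
    ((doublings n * (len size_body).+1).+1 +
      len (assign 1 (Cst 10 * Var 3 * Var 4))).+1).+1).+1.

Lemma runs_size :
  runs L w size_prog size_time (init_construct n)
    (fun s => [/\ memory s = (fun=> 0), regs s 0 = n & regs s 1 = K]).
Proof.
have dp := ltn_expl (doublings n) (isT : 1 < 2).
apply: runs_seq; apply: runs_assign => //=; try lia.
move=> s1 m1 r1 x1; apply: runs_seq; apply: runs_assign => //=; try lia.
move=> s2 m2 r2 x2; apply: runs_seq.
pose Inv i s := [/\ memory s = (fun=> 0) /\ regs s 0 = n, i <= doublings n,
  regs s 3 = doublings n - i, regs s 4 = 2 ^ (doublings n - i) &
  regs s 5 = (0 < i)].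
have I2 : Inv (doublings n) s2.
  split; first split; rewrite ?m2 ?m1 ?subnn ?expn0 ?r2 //.
  - by rewrite x2 // x1.
  - by rewrite x2 // x1.
  - by rewrite x2.
have sq := sqr_doublings_le n_gt0.
have pn : 2 ^ doublings n <= 4 * n.
  by apply: leq_trans sq; rewrite leq_pmull // expn_gt0.
apply: runs_mono (runs_while _ _ I2); last 2 first.
- move=> i s [[m0 r0] iD r3 r4 r5]; split; first by rewrite r5.
  have ppi : 2 ^ (doublings n - i.+1) + 2 ^ (doublings n - i.+1) = 2 ^ (doublings n - i).
    by rewrite addnn -mul2n -expnS; congr (2 ^ _); lia.
  have pD : 2 ^ (doublings n - i) <= 2 ^ doublings n by rewrite leq_exp2l // leq_subr.
  have pp := leq_mul pD pD.
  apply: runs_seq; apply: runs_assign => //=; rewrite ?r3; [by do ?[split=> //]; lia|by lia|].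
  move=> s3 m3 r33 x3.
  apply: runs_seq; apply: runs_assign => //=; rewrite ?x3 ?r4 ?ppi //; [by do ?[split=> //]; lia|by lia|].
  move=> s4 m4 r44 x4; have r04 : regs s4 0 = n by rewrite x4 // x3.
  apply: runs_assign => //=; rewrite r44 r04; [by do ?[split=> //]; lia|by lia|].
  move=> s5 m5 r5' x5; split; first split.
  + by rewrite m5 m4 m3.
  + by rewrite x5 // x4 // x3.
  + exact: ltnW.
  + by rewrite x5 // x4 // r33; lia.
  + by rewrite x5 // r44.
  + rewrite r5' ltnNge le_sqr_doublings //.
    by case: i iD {ppi pD pp r3 r4 r5 r33 r44 r5'} => [|i] iD; rewrite ?subn0 ?ltnn //= ; have -> : doublings n - i.+1 < doublings n by lia.
- by move=> s [_ _ _ _ ->].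
move=> s [[m0 r0] _ r3 r4 _]; rewrite subn0 in r3 r4.
have K1 := num_samples_le n_gt0; rewrite /num_samples in K1.
apply: runs_assign => //=; rewrite ?r3 ?r4; [by do ?[split=> //]; nia|by nia|].
move=> s' m' r1' x'; split; [by rewrite m'|by rewrite x'|].
by rewrite r1' /K /num_samples; lia.
Qed.

(** The bounds are imposed at all indices: cells not yet drawn hold 0, which is below [n]. *)
Definition tape_ok (m : nat -> nat) : Prop :=
  [/\ forall i, m (S_addr i) < n, forall j, m (X_addr j) < n,
      forall v, m (center_addr v) = 0 & forall x, m (4 * x + 3) = 0].

Definition S_time : nat := (1 + len (store (S_cell (Var 2)) (Var 3))).+1.
Definition X_time : nat := (len (assign 4 (Var 2 / Var 1)) +
  (1 + len (store (X_cell (Var 2)) (Var 3))).+1).+1.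

Lemma good_S_body (R : realType) E j s k T (g : nat -> R) :
  j < K -> regs s 2 = j -> regs s 0 = n ->
  (forall x s', x \in S_dist n j -> memory s' = [eta memory s with S_addr j |-> x] ->
     (forall r, r <= 2 -> regs s' r = regs s r) -> good L w E T (g x) (k, s')) ->
  good L w E (S_time + T) (mean (S_dist n j) g) (S_body :: k, s).
Proof.
move=> jK r2 r0 H; rewrite /S_time add1n 2!addSn; apply: good_seq.
apply: (good_draw (d := 3)); [exact: S_dist_neq0|by rewrite /= r0|].
move=> x xS; have xn : x < n by move: xS; rewrite mem_iota; lia.
apply: (good_runs (Q := fun s' => memory s' = [eta memory s with S_addr j |-> x] /\
  forall r, r <= 2 -> regs s' r = regs s r)) => [|s' [m' r']]; last exact: H.
apply: runs_store => /=; rewrite ?r2; try by do ?[split=> //]; lia.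
move=> s' -> x'; split=> // r r_le; rewrite x' /=; last by rewrite /nvars; lia.
by rewrite ltn_eqF.
Qed.

Lemma X_dist_lt j x : x \in X_dist L K j -> x < n.
Proof.
rewrite /X_dist; case e: (nbr_words _ _) => [|y s]; first by rewrite inE => /eqP ->.
by rewrite -e => /mem_nbr_words /adj_wordsP [_ [v [_ -> _]]].
Qed.

Lemma good_X_body (R : realType) E j s k T (g : nat -> R) :
  j < n * K -> regs s 2 = j -> regs s 0 = n -> regs s 1 = K ->
  (forall x s', x \in X_dist L K j -> memory s' = [eta memory s with X_addr j |-> x] ->
     (forall r, r <= 2 -> regs s' r = regs s r) -> good L w E T (g x) (k, s')) ->
  good L w E (X_time + T) (mean (X_dist L K j) g) (X_body :: k, s).
Proof.
move=> jK r2 r0 r1 H.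
have jn : j %/ K < n by rewrite ltn_divLR.
rewrite /X_time addSn; apply: good_seq; rewrite -addnA.
apply: (good_runs (Q := fun s1 => [/\ memory s1 = memory s, regs s1 4 = j %/ K &
  forall r, r <= 2 -> regs s1 r = regs s r])).
  apply: runs_assign => //=; rewrite ?r1 ?r2; [by do ?[split=> //]; lia|by lia|].
  by move=> s1 m1 r41 x1; split=> // r r_le; apply: x1; rewrite ?/nvars; lia.
move=> s1 [m1 r41 x1]; rewrite add1n 2!addSn; apply: good_seq.
apply: (good_draw (d := 3)); [exact: X_dist_neq0| |].
  by rewrite /= r41 /X_dist; case: (nbr_words _ _).
move=> x xS; have xn := X_dist_lt xS.
apply: (good_runs (Q := fun s' => memory s' = [eta memory s with X_addr j |-> x] /\
  forall r, r <= 2 -> regs s' r = regs s r)) => [|s' [m' r']]; last exact: H.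
apply: runs_store => /=; rewrite ?x1 // ?r2; try by do ?[split=> //]; lia.
move=> s' -> x'; rewrite m1; split=> // r r_le; rewrite x' /=; last by rewrite /nvars; lia.
by rewrite ltn_eqF // x1.
Qed.

Variable mt : nat -> nat.
Hypothesis mt_ok : tape_ok mt.

(** The truncated difference covers three cases: vertices after [j %/ K] have seen all draws, those
    before it none, and the current one the draws from [j %% K] on. *)
Definition center_inv (j : nat) (m : nat -> nat) : Prop :=
  [/\ forall i, m (S_addr i) = mt (S_addr i), forall i, m (X_addr i) = mt (X_addr i),
      forall v, v < n -> center m v =
        first_center G (S_tape mt) (drop (j - v * K) (iota 0 K)) v &
      forall x, m (4 * x + 3) = 0].

Let fc_le s v : first_center G (S_tape mt) s v <= n.
Proof. by case: mt_ok => S_lt _ _ _; elim: s => //= i s IH; case: ifP => // _; exact: S_lt. Qed.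

Lemma runs_center_body j s : j < n * K -> regs s 2 = j -> regs s 0 = n ->
  regs s 1 = K -> center_inv j.+1 (memory s) ->
  runs L w center_body (len center_body) s (fun s' =>
    center_inv j (memory s') /\ forall r, r <= 2 -> regs s' r = regs s r).
Proof.
move=> jK r2 r0 r1 [mS mX mC mH]; have [S_lt X_lt _ _] := mt_ok.
have jn : j %/ K < n by rewrite ltn_divLR.
have jm : j %% K < K by rewrite ltn_mod.
apply: runs_seq; apply: runs_assign => //=; rewrite ?r1 ?r2; [by do ?[split=> //]; lia|by lia|].
move=> s1 m1 r31 x1.
have Sj := S_lt (j %% K); have e1 := mS (j %% K); rewrite /S_addr in e1 Sj.
apply: runs_seq; apply: runs_assign => //=; rewrite ?m1 ?x1 // ?r1 ?r2 ?e1;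
  [by do ?[split=> //]; lia|by lia|].
move=> s2 m2 r42 x2.
have r32 : regs s2 3 = j %/ K by rewrite x2.
have Cv := mC _ jn; rewrite /center /center_addr in Cv.
have Cw : memory s (4 * (j %/ K) + 2) <= n by rewrite Cv.
have eb : eval L (Adj (Var 3) (Var 4)) s2 = adj_words G (j %/ K) (mt (4 * (j %% K))).
  by rewrite /= r32 r42.
apply: runs_store.
- by rewrite /= r32; do ?[split=> //]; lia.
- apply: (fits_select eb); rewrite /= ?r32 ?r42 ?m2; try by do ?[split=> //]; lia.
move=> s' m' x'; rewrite (eval_select _ _ eb) /= r32 r42 m2 in m'.
split; last first.
  move=> r r_le; rewrite x' ?x2 ?x1 //; rewrite /nvars; lia.
have dv := divn_eq j K.
rewrite m'; split=> [i|i|v vn|x] /=.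
- by rewrite /S_addr; case: eqP => [|_]; [lia|exact: mS].
- by rewrite /X_addr; case: eqP => [|_]; [lia|exact: mX].
- rewrite /center /center_addr /=; have [e|ne] := eqVneq v (j %/ K).
    rewrite e eqxx Cv.
    have -> : j - j %/ K * K = j %% K by lia.
    have -> : j.+1 - j %/ K * K = (j %% K).+1 by lia.
    by rewrite (drop_nth 0 (n := j %% K)) ?size_iota // nth_iota // addn1.
  rewrite ifF; last by apply/eqP; lia.
  have := mC _ vn; rewrite /center /center_addr => ->.
  have [lt|gt] : v < j %/ K \/ j %/ K < v by lia.
    by rewrite !drop_oversize // size_iota; nia.
  have -> : j - v * K = 0 by nia.
  by have -> : j.+1 - v * K = 0 by nia.
- by case: eqP => [|_]; [lia|exact: mH].
Qed.

(** Later iterations may replace a selected neighbor by another one, but never clear it; hence the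
    last clause only asks for a nonzero entry. *)
Definition hit_inv (j : nat) (m : nat -> nat) : Prop :=
  [/\ forall i, m (X_addr i) = mt (X_addr i),
      forall v, v < n -> center m v = first_center G (S_tape mt) (iota 0 K) v,
      forall u c, u < n -> c <= n -> hit n m u c != 0 ->
        [/\ c != 0, adj_words G u (hit n m u c).-1 &
            center m (hit n m u c).-1 = c] &
      forall i, j <= i < n * K -> adj_words G (i %/ K) (mt (X_addr i)) ->
        center m (mt (X_addr i)) != 0 ->
        hit n m (i %/ K) (center m (mt (X_addr i))) != 0].

Lemma runs_hit_body j s : j < n * K -> regs s 2 = j -> regs s 0 = n ->
  regs s 1 = K -> hit_inv j.+1 (memory s) ->
  runs L w hit_body (len hit_body) s (fun s' =>
    hit_inv j (memory s') /\ forall r, r <= 2 -> regs s' r = regs s r).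
Proof.
move=> jK r2 r0 r1 [mX mC sound_hit sampled]; have [S_lt X_lt _ _] := mt_ok.
have jn : j %/ K < n by rewrite ltn_divLR.
apply: runs_seq; apply: runs_assign => //=; rewrite ?r1 ?r2; [by do ?[split=> //]; lia|by lia|].
move=> s1 m1 r31 x1.
have Xj := X_lt j; have e1 := mX j; rewrite /X_addr in e1 Xj.
set x := mt (4 * j + 1) in Xj e1.
apply: runs_seq; apply: runs_assign => //=; rewrite ?m1 ?x1 // ?r2 ?e1;
  [by do ?[split=> //]; lia|by lia|].
move=> s2 m2 r42 x2.
have Cx := mC _ Xj; set c := center _ x in Cx.
have cn : c <= n by rewrite Cx.
have ec : memory s (4 * x + 2) = c by [].
apply: runs_seq; apply: runs_assign => //=; rewrite ?m2 ?m1 ?r42 ?ec //;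
  [by do ?[split=> //]; lia|by lia|].
move=> s3 m3 r53 x3.
set u := j %/ K in jn r31.
have r33 : regs s3 3 = u by rewrite x3 // x2.
have r43 : regs s3 4 = x by rewrite x3.
have r03 : regs s3 0 = n by rewrite x3 // x2 // x1.
have ha := hit_index_lt jn cn.
have un : u * (n + 1) <= n.+1 * n.+1 by nia.
have e2 : 4 * (u * (n + 1) + c) + 3 = hit_addr n u c by rewrite addn1.
have hle : hit n (memory s) u c <= n.
  have [->//|h] := eqVneq (hit n (memory s) u c) 0.
  have [_ /adj_wordsP [_ [v [_ hv _]]] _] := sound_hit _ _ jn cn h.
  by have := ltn_ord v; lia.
pose t := adj_words G u x && (0 < c).
have eb : eval L (Adj (Var 3) (Var 4) * (Cst 0 < Var 5))%X s3 = t.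
  by rewrite /= r33 r43 r53 /t mulnb.
apply: runs_store.
- by rewrite /= r33 r53 r03; do ?[split=> //]; lia.
- apply: (fits_select eb); rewrite /= ?r33 ?r43 ?r53 ?r03 ?e2; try by do ?[split=> //]; try lia; case: adj_words; case: (0 < c); lia.
  by rewrite m3 -/(hit n (memory s) u c); lia.
move=> s' m' x'; rewrite (eval_select _ _ eb) /= r33 r43 r53 r03 e2 m3 in m'.
split; last first.
  move=> r r_le; rewrite x' ?x3 ?x2 ?x1 //; rewrite /nvars; lia.
have hE u' c' : u' < n -> c' <= n -> hit n (memory s') u' c' =
    if (u' == u) && (c' == c) && t then x.+1 else hit n (memory s) u' c'.
  move=> un' cn'; rewrite m' /hit /=.
  have -> : (hit_addr n u' c' == hit_addr n u c) = (u' == u) && (c' == c).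
    apply/eqP/andP => [|[/eqP -> /eqP -> //]]; rewrite /hit_addr => e.
    have e' : u' * n.+1 + c' = u * n.+1 + c by lia.
    have uu : u' = u.
      by move/(congr1 (divn^~ n.+1)): e'; rewrite !divnMDl // !divn_small // !addn0.
    by split; apply/eqP; lia.
  case: (boolP ((u' == u) && (c' == c))) => //= /andP [/eqP -> /eqP ->].
  by case: (t); rewrite ?addn1.
have cE v : center (memory s') v = center (memory s) v.
  by rewrite m' /center /center_addr /hit_addr /=; case: eqP => //; lia.
split.
- by move=> i; rewrite m' /X_addr /hit_addr /=; case: eqP => [|_]; [lia|exact: mX].
- by move=> v vn; rewrite cE mC.
- move=> u' c' un' cn'; rewrite hE //; case: ifP => [|_]; last first.
    by move=> h; rewrite cE; exact: sound_hit.
  move=> /andP [/andP [/eqP -> /eqP ->] /andP [ax c0]] _; split=> //.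
    by rewrite -lt0n.
- move=> i /andP [ji iK] ax; rewrite cE => c0.
  have iKn : i %/ K < n by rewrite ltn_divLR.
  have cin : center (memory s) (mt (X_addr i)) <= n by rewrite mC.
  rewrite hE //; case: ifP => // nt.
  have [e|ne] := eqVneq i j; last by apply: sampled => //; lia.
  rewrite e in ax c0 nt *.
  have tt' : t by apply/andP; split; [exact: ax | rewrite lt0n; exact: c0].
  by rewrite tt' !eqxx in nt.
Qed.

End Correctness.

(** * Correctness of the query and of the whole construction *)

Section Oracle.
Local Open Scope nat_scope.
Variables (n : nat) (G : sgraph n) (L : adjlist G) (w : nat).
Hypothesis n_gt0 : 0 < n.
Hypothesis word_large : 256 * (n.+1 * n.+1) <= 2 ^ w.

Lemma adj_words_lt x y : adj_words G x y.-1 -> y <= n.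
Proof. by move=> /adj_wordsP [_ [v [_ yv _]]]; have := ltn_ord v; lia. Qed.

Lemma query_oracle m : sound G m ->
  adjacency_oracle L w query (len query) m (kept L m).
Proof.
move=> [csound hsound]; split=> // u v.
have cle (x : 'I_n) : center m x <= n.
  have [->//|/(csound _ (ltn_ord x))] := eqVneq (center m x) 0; exact: adj_words_lt.
have hle (x y : 'I_n) : hit n m x (center m y) <= n.
  have [->//|h] := eqVneq (hit n m x (center m y)) 0.
  by have [_ /adj_words_lt] := hsound _ _ (ltn_ord x) (cle y) h.
have un := ltn_ord u; have vn := ltn_ord v.
have cu := cle u; have cv := cle v; have huv := hle u v; have hvu := hle v u.
have i1 := hit_index_lt un cv; have i2 := hit_index_lt vn cu.
have nn : 2 * n + 1 <= n.+1 * n.+1 by nia.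
have un1 : u * (n + 1) <= n.+1 * n.+1 by nia.
have vn1 : v * (n + 1) <= n.+1 * n.+1 by nia.
suff: runs L w query (len query) (init_query m u v)
    (fun s => regs s 0 == kept L m u v :> nat).
  move=> /(_ [::]) [s' r H]; rewrite -[len query]addn0 (always_reach _ _ r).
  exact: H.
have e1 : 4 * (u * (n + 1) + center m v) + 3 = hit_addr n u (center m v) by rewrite addn1.
have e2 : 4 * (v * (n + 1) + center m u) + 3 = hit_addr n v (center m u) by rewrite addn1.
have eu : m (4 * u + 2) = center m u by [].
have ev : m (4 * v + 2) = center m v by [].
apply: runs_seq; apply: runs_assign => //=; rewrite ?eu; [by do ?[split=> //]; lia|by lia|].
move=> s1 m1 r1 x1.
apply: runs_seq; apply: runs_assign => //=; rewrite x1 //= ?m1 ?ev; [by do ?[split=> //]; lia|by lia|].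
move=> s2 m2 r2 x2.
have x2' x : x < nvars -> x != 3 -> x != 4 -> regs s2 x = regs (init_query m u v) x.
  by move=> ? ? ?; rewrite x2 // x1.
apply: runs_seq; apply: runs_assign => //=; rewrite ?(x2' 0) ?(x2' 1) // ?r2 /= ?m2 ?m1 ?e1
  -?[m (hit_addr n u _)]/(hit n m u _); [by do ?[split=> //]; lia|by lia|].
move=> s3 m3 r3 x3.
have x3' x : x < nvars -> x != 3 -> x != 4 -> x != 5 ->
    regs s3 x = regs (init_query m u v) x.
  by move=> ? ? ? ?; rewrite x3 // x2'.
have r33 : regs s3 3 = center m u by rewrite x3 // x2.
apply: runs_seq; apply: runs_assign => //=; rewrite ?(x3' 0) ?(x3' 2) // ?r33 /= ?m3 ?e2
  -?[m (hit_addr n v _)]/(hit n m v _); [by do ?[split=> //]; lia|by lia|].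
move=> s4 m4 r4 x4.
have x4' x : x < 3 -> regs s4 x = regs (init_query m u v) x.
  by case: x => [|[|[|//]]] _; rewrite x4 // x3'.
have r43 : regs s4 3 = center m u by rewrite x4.
have r44 : regs s4 4 = center m v by rewrite x4 // x3.
have r45 : regs s4 5 = hit n m u (center m v) by rewrite x4.
have b2w (b : bool) : b < 2 ^ w by case: b; lia.
apply: runs_assign => //=; rewrite ?(x4' 1) ?(x4' 2) // r43 r44 r45 r4 /=.
- by do ?[split=> //]; lia.
- by case: (adj_words _ _ _); lia.
move=> s5 _ -> _.
rewrite adj_wordsE -/(deg L u) -/(deg L v) !addn1 /kept_rel /keep.
have dN (a b : nat) : 1 - (a < b) = (b <= a) by lia.
rewrite !dN.
have bb (g a b c d e f h i : bool) :
  g * (0 < a + b + c * d + e + f + h * i) =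
  g && ([|| a, b | c && d] || [|| e, f | h && i]).
  by case: g a b c d e f h i => [] [] [] [] [] [] [] [] [].
exact/eqP/bb.
Qed.

Local Open Scope ring_scope.

Definition build_time (n : nat) : nat :=
  (size_time n + (for_time 2 (Var 1) (num_samples n) S_time +
    (for_time 2 (Var 0 * Var 1) (n * num_samples n) X_time +
      (for_time 2 (Var 0 * Var 1) (n * num_samples n) (len center_body) +
        (for_time 2 (Var 0 * Var 1) (n * num_samples n) (len hit_body) +
          0)).+1).+1).+1).+1%N.

Definition max_edges (n : nat) : nat :=
  (2 * (n * (1 + num_samples n + num_samples n)))%N.

Definition success (R : realType) (s : state) : Prop := exists H : sgraph n,
  [/\ spanner R 3 G H, (num_edges H <= max_edges n)%N &
      adjacency_oracle L w query (len query) (memory s) H].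

Let K := num_samples n.
Let r := (2 ^ doublings n)%N.
Let l := (2 * doublings n)%N.

(** Once the tapes are drawn, the rest of the run is deterministic and succeeds unless the tape is
    bad, where the claimed failure bound is 1. *)
Lemma good_construct (R : realType) :
  good L w (success R) (build_time n)
    (avg (S_dist n) S_addr K
      (avg (X_dist L K) X_addr (n * K) (tape_bad R L r l)) (fun=> 0%N))
    ([:: construct], init_construct n).
Proof.
have K0 : (0 < K)%N := num_samples_gt0 n.
have Kn : (K <= 40 * n)%N := num_samples_le n_gt0.
have nKw : (n * K < 2 ^ w)%N by nia.
have Kw : (K < 2 ^ w)%N by nia.
have nw : (n < 2 ^ w)%N by nia.
have w0 : (0 < w)%N by case: (w) word_large => //; rewrite expn0; lia.
apply: good_seq; apply: good_runs (runs_size L n_gt0 word_large) _ => s1 [m1 r01 r11].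
rewrite -m1; apply: good_seq.
apply: (good_for (Inv := fun=> tape_ok n)) => //=; rewrite ?r11 //.
- by rewrite m1.
- move=> m j x [m_S m_X m_C m_H] jK; rewrite mem_iota => xS; split=> i /=.
  + by case: eqP => // _; lia.
  + by rewrite /S_addr /X_addr; case: eqP => [|_]; [lia|exact: m_X].
  + by rewrite /S_addr /center_addr; case: eqP => [|_]; [lia|exact: m_C].
  + by rewrite /S_addr; case: eqP => [|_]; [lia|exact: m_H].
- by move=> j s k T g jK r2 x2; apply: good_S_body => //; rewrite x2 ?r01.
move=> s2 ok2 x2; apply: good_seq.
have r02 : regs s2 0 = n by rewrite x2 // r01.
have r12 : regs s2 1 = K by rewrite x2 // r11.
have fnK s : regs s 0 = n -> regs s 1 = K -> fits L w nvars (Var 0 * Var 1)%X s.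
  by move=> r0 r1; rewrite /= r0 r1.
have enK s : regs s 0 = n -> regs s 1 = K -> eval L (Var 0 * Var 1)%X s = (n * K)%N.
  by move=> r0 r1; rewrite /= r0 r1.
apply: (good_for (Inv := fun j m => tape_ok n m /\
  forall i, (j <= i < n * K)%N -> m (X_addr i) \in X_dist L K i)) => //.
- exact: fnK.
- exact: enK.
- by split=> // i; lia.
- move=> m j x [[m_S m_X m_C m_H] m_D] jK xS; split; first split=> i /=.
  + by rewrite /S_addr /X_addr; case: eqP => [|_]; [lia|exact: m_S].
  + by case: eqP => // _; apply: X_dist_lt xS.
  + by rewrite /X_addr /center_addr; case: eqP => [|_]; [lia|exact: m_C].
  + by rewrite /X_addr; case: eqP => [|_]; [lia|exact: m_H].
  + move=> i ji /=; case: eqP => [e|ne]; last by apply: m_D; rewrite /X_addr in ne; lia.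
    by have -> : i = j by rewrite /X_addr in e; lia.
- by move=> j s k T g jK r2 x3; apply: good_X_body => //; rewrite x3.
move=> s3 [ok3 D3] x3; apply: good_seq.
have r03 : regs s3 0 = n by rewrite x3.
have r13 : regs s3 1 = K by rewrite x3.
set mt := memory s3 in ok3 D3 *.
have [m_S m_X m_C m_H] := ok3.
apply: (good_runs (Q := fun s => center_inv G mt 0 (memory s) /\
  forall x, (x < 2)%N -> regs s x = regs s3 x)).
  apply: (runs_for (Inv := center_inv G mt)) => //; [exact: fnK|exact: enK| |].
    split=> // v vn; rewrite /center -/mt m_C drop_oversize // size_iota -/K; nia.
  by move=> j s jK r2 x4; apply: runs_center_body => //; rewrite x4.
move=> s4 [[m4S m4X m4C m4H] x4].
apply: (good_runs (Q := fun s => hit_inv G mt 0 (memory s))).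
  have r04 : regs s4 0 = n by rewrite x4.
  have r14 : regs s4 1 = K by rewrite x4.
  apply: (runs_for (Inv := hit_inv G mt)) => //; [exact: fnK|exact: enK| |].
    split=> //; first by move=> v vn; rewrite m4C // sub0n drop0.
      by move=> u c _ _; rewrite /hit /hit_addr m4H.
    by move=> i; lia.
  by move=> j s jK r2 x5; apply: runs_hit_body => //; rewrite x5.
move=> s5 [m5X m5C m5H m5D]; apply: good_done; last by rewrite /tape_bad.
rewrite /tape_bad; case: asboolP => [[cent samp]|_]; [left|by right].
have snd : sound G (memory s5).
  split=> // v vn; rewrite m5C // => /first_center_neq0 [i _ [-> //]].
exists (kept L (memory s5)); split; last exact: query_oracle.
  exact: kept_spanner.
apply: (num_edges_kept (S := S_tape mt) (X := X_tape mt) (r := r) (l := l)) => //.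
- exact/ltnW/sqr_doublings_gt.
- by rewrite /r expn_gt0.
- move=> j jK dj; have := D3 j; rewrite jK => /(_ isT).
  rewrite /X_dist -/(X_tape mt j); move: dj; rewrite /deg.
  by case e: (nbr_words _ _).
- move=> u un; have [//|h] := eqVneq (hit n (memory s5) u 0) 0%N.
  by have [] := m5H u 0%N un isT h.
Qed.

End Oracle.

(** * Asymptotics *)

Section Asymptotics.
Variable R : realType.

(** With [d = doublings n], the bounds [2 ^ d <= 2 sqrt n] and [d <= (2 / ln 2) ln n] turn
    [n * 5 * (2 d) * 2 ^ d] into [(40 / ln 2) n sqrt n ln n]. *)
Lemma Otilde_num_samples (f : nat -> nat) C :
  (forall n, (0 < n)%N -> (f n <= C * (n * num_samples n))%N) ->
  Otilde (fun n => (f n)%:R : R) (fun n => n%:R `^ (3 / 2)).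
Proof.
move=> fC; exists (C%:R * (40 / ln 2)), 1%N => n n2.
have n0 : (0 < n)%N by lia.
have nR : (0 : R) < n%:R by rewrite ltr0n.
have ln2 : (0 : R) < ln 2 by rewrite ln_gt0 // ltr1n.
have sq := sqr_doublings_le n0; set d := doublings n in sq.
have dln : d%:R <= 2 / ln 2 * ln n%:R :> R.
  rewrite mulrAC ler_pdivlMr //.
  (* For [n >= 2] the cube absorbs the factor 4 in [4 * n]. *)
  have : ln ((2 ^ d * 2 ^ d)%:R) <= ln ((n ^ 3)%:R) :> R.
    rewrite ler_ln ?posrE ?ltr0n ?muln_gt0 ?expn_gt0 ?n0 // ler_nat.
    by apply: leq_trans sq _; rewrite !expnS expn0; nia.
  rewrite natrM !natrX lnM ?posrE ?exprn_gt0 // !lnXn //.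
  have : 0 <= ln n%:R :> R by rewrite ln_ge0 // ler1n.
  rewrite -!(mulr_natr (ln _)); nra.
have dsq : (2 ^ d)%:R <= 2 * Num.sqrt n%:R :> R.
  rewrite -(@ler_pXn2r _ 2) ?nnegrE ?mulr_ge0 ?sqrtr_ge0 //.
  rewrite exprMn sqr_sqrtr ?ler0n // -natrX -natrX -natrM ler_nat.
  by rewrite -mulnn.
have -> : n%:R `^ (3 / 2) = n%:R * Num.sqrt n%:R :> R.
  have -> : 3 / 2 = 1 + 2^-1 :> R by field.
  by rewrite powRD ?gt_eqF ?implybT // powRr1 ?ler0n // powR12_sqrt ?ler0n.
rewrite expr1.
apply: (@le_trans _ _ (C * (n * num_samples n))%:R); first by rewrite ler_nat fC.
rewrite /num_samples -/d !natrM.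
have -> : C%:R * (40 / ln 2) * (n%:R * Num.sqrt n%:R) * ln n%:R =
  C%:R * (n%:R * (5 * (2 * (2 / ln 2 * ln n%:R)) * (2 * Num.sqrt n%:R))) :> R.
  by field; rewrite gt_eqF.
have d0 : 0 <= d%:R :> R by [].
by do ![apply: ler_pM; rewrite ?mulr_ge0 ?ler0n //].
Qed.

Lemma for_time_le r e N t M : (0 < M)%N -> (N <= M)%N ->
  (for_time r e N t <= (len (assign r e) + decr_len r + t + 4) * M)%N.
Proof. by rewrite /for_time; nia. Qed.

Lemma build_time_le : exists C, forall n, (0 < n)%N ->
  (build_time n <= C * (n * num_samples n))%N.
Proof.
have ft r e t : exists C, forall N M, (0 < M)%N -> (N <= M)%N ->
    (for_time r e N t <= C * M)%N.
  by eexists => N M M0 NM; exact: for_time_le.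
have [C1 H1] := ft 2%N (Var 1) S_time.
have [C2 H2] := ft 2%N (Var 0 * Var 1)%X X_time.
have [C3 H3] := ft 2%N (Var 0 * Var 1)%X (len center_body).
have [C4 H4] := ft 2%N (Var 0 * Var 1)%X (len hit_body).
have [C0 H0] : exists C, forall n, (0 < n)%N ->
    (size_time n <= C * (n * num_samples n))%N.
  exists ((len (assign 4 (Cst 1)) + len (assign 5 (Cst 1)) + (len size_body) +
    len (assign 1 (Cst 10 * Var 3 * Var 4))) + 5)%N => n n0.
  rewrite /size_time; move: (len _) (len _) (len _) (len _) => a b c d.
  have dK : (doublings n <= num_samples n)%N.
    by rewrite /num_samples; have := ltn_expl (doublings n) (isT : 1 < 2)%N; nia.
  have dd : (0 < doublings n)%N by [].
  have dnK : (doublings n <= n * num_samples n)%N by nia.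
  by nia.
exists (C0 + C1 + C2 + C3 + C4 + 4)%N => n n0.
have K0 := num_samples_gt0 n.
have nK0 : (0 < n * num_samples n)%N by rewrite muln_gt0 n0.
have KnK : (num_samples n <= n * num_samples n)%N by rewrite leq_pmull.
have := H0 _ n0; have := H1 _ _ nK0 KnK.
have := H2 _ _ nK0 (leqnn _); have := H3 _ _ nK0 (leqnn _).
have := H4 _ _ nK0 (leqnn _).
rewrite /build_time; nia.
Qed.

Lemma max_edges_le n : (0 < n)%N -> (max_edges n <= 6 * (n * num_samples n))%N.
Proof. by rewrite /max_edges; have := num_samples_gt0 n; nia. Qed.

End Asymptotics.

Theorem mainTheorem3 (R : realType) :
  exists (P Q : prog) (kappa : nat) (T q m : nat -> nat) (c : R),
    (0 < kappa)%N /\ 0 < c /\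
    Otilde (fun n => (T n)%:R : R) (fun n => n%:R `^ (3 / 2)) /\
    Otilde (fun n => (q n)%:R : R) (fun=> 1) /\
    Otilde (fun n => (m n)%:R : R) (fun n => n%:R `^ (3 / 2)) /\
    forall (n : nat) (G : sgraph n) (L : adjlist G), (0 < n)%N ->
      always L (word_size kappa n) (T n) xpredT
        ([:: P], init_construct n) /\
      1 - 1 / n%:R `^ c <=
      prob R L (word_size kappa n) (T n)
        (fun s => exists H : sgraph n,
          [/\ spanner R 3 G H, (num_edges H <= m n)%N &
              adjacency_oracle L (word_size kappa n) Q (q n) (memory s) H])
        ([:: P], init_construct n).
Proof.
exists construct, query, 10%N, build_time, (fun=> len query), max_edges, 1.
do 2![split=> //]; split.
  by have [C HC] := build_time_le; exact: Otilde_num_samples HC.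
split; first by exists (len query)%:R, 0%N => n _; rewrite expr0 !mulr1.
split; first exact: (Otilde_num_samples _ max_edges_le).
move=> n G L n0; rewrite powRr1 // div1r.
have [alw pr] := good_construct L n0 (word_size_bound n) R; split=> //.
have [n1|n1] := leqP n 1.
  (* The failure analysis assumes [n > 1]; for a single vertex the required probability is 0. *)
  have -> : n%:R = 1 :> R by rewrite (_ : n = 1%N) //; lia.
  by rewrite invr1 subrr; exact: prob_ge0.
apply: le_trans pr; rewrite lerB //; apply: avg_tape_bad => //.
- exact/ltnW/sqr_doublings_gt.
- by rewrite expn_gt0.
- by rewrite mul2n -addnn expnD; exact: sqr_doublings_gt.
Qed.
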